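(* Let $T=T_0+1$. Suppose (autoregressive model with covariates) that for each $i=1,\dots,N$, $$Y^N_{iT}(x)=\sum_{t=1}^{T_0}\langle\beta_t(x,\cdot),Y^N_{it}\rangle_{\mathcal H}+\sum_{\ell=1}^p\eta_\ell(x)Z_{i\ell}+\varepsilon_{iT}(x),\qquad x\in\mathcal X,$$ with $\beta_t\in L^2(\mathcal X\times\mathcal X,\mu\otimes\mu)$, $\eta_\ell\in\mathcal H$, and $\varepsilon_{1T},\dots,\varepsilon_{NT}$ independent mean-zero $\mathcal H$-valued random elements with $\|\varepsilon_{iT}\|_{\mathcal H}\le\sigma$ a.s. The pre-treatment outcomes and covariates are treated as fixed, and $\hat\gamma\in\mathbb R^{N-1}$ with $\sum_{i=2}^N\hat\gamma_i=1$ is a fixed weight vector. Let $\hat\nu^N_{1T}$ be the generic weighting estimator built from $\hat\gamma$. Then for any $\delta>0$, with probability at least $1-2e^{-\delta^2/2}$, $$d(\nu^N_{1T},\hat\nu^N_{1T})\le\sqrt{\sum_{t=1}^{T_0}\|\beta_t\|^2_{\mathcal H\times\mathcal H}}\sqrt{\sum_{t=1}^{T_0}\Big\|Y_{1t}-\sum_{i=2}^N\hat\gamma_iY_{it}\Big\|^2_{\mathcal H}}+\sqrt{\sum_{\ell=1}^p\|\eta_\ell\|^2_{\mathcal H}}\,\Big\|Z_1-\sum_{i=2}^N\hat\gamma_iZ_i\Big\|_2+\delta\sigma(1+\|\hat\gamma\|_2).$$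
   Context: Let $(\mathcal X,\mathcal A,\mu)$ be either a compact interval $\mathcal I\subset\mathbb R$ with Lebesgue measure or the finite set $\{1,\dots,d\}$ with counting measure, and let $\mathcal H=L^2(\mathcal X,\mathcal A,\mu)$ (so $\mathcal H=L^2(\mathcal I)$ or $\mathcal H=\mathbb R^d$), with inner product $\langle f,g\rangle_{\mathcal H}=\int_{\mathcal X}fg\,d\mu$ and norm $\|\cdot\|_{\mathcal H}$. $(\mathcal M,d)$ is a metric space and $\Psi:\mathcal M\to\mathcal H$ is an isometry, $d(a,b)=\|\Psi(a)-\Psi(b)\|_{\mathcal H}$; its image $\mathcal Y=\Psi(\mathcal M)$ is nonempty, closed and convex in $\mathcal H$. Panel setting: units $i=1,\dots,N$, periods $t=1,\dots,T$, $1\le T_0<T$; transformed control potential outcomes $Y^N_{it}\in\mathcal Y$ and observed outcomes $Y_{it}\in\mathcal Y$ with $Y_{it}=Y^N_{it}$ whenever $i\ge2$ or $t\le T_0$; the counterfactual of interest is $\nu^N_{1T}=\Psi^{-1}(Y^N_{1T})$. Each unit has covariates $Z_i=(Z_{i1},\dots,Z_{ip})'\in\mathbb R^p$. Generic weighting estimator: given weights $\hat\gamma\in\mathbb R^{N-1}$ with $\sum_{i=2}^N\hat\gamma_i=1$ not depending on the post-treatment outcomes, set $\hat Y^N_{1T}=\sum_{i=2}^N\hat\gamma_iY_{iT}$, $\tilde Y^N_{1T}=\arg\min_{y\in\mathcal Y}\|y-\hat Y^N_{1T}\|_{\mathcal H}$, and $\hat\nu^N_{1T}=\Psi^{-1}(\tilde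 Y^N_{1T})$. For $\beta\in L^2(\mathcal X\times\mathcal X)$, $\|\beta\|_{\mathcal H\times\mathcal H}=\big(\int\int\beta(x,y)^2\,d\mu(x)d\mu(y)\big)^{1/2}$. *)

(* Defs.v *)
From HB Require Import structures.
From mathcomp Require Import all_boot all_order all_algebra.
From mathcomp Require Import all_classical all_reals all_analysis.
Set Implicit Arguments. Unset Strict Implicit. Unset Printing Implicit Defensive.
Import Order.TTheory GRing.Theory Num.Theory.
Local Open Scope classical_set_scope.
Local Open Scope ring_scope.

(* The underlying measure space (X, A, mu) is encoded as a measure on the real
   line concentrated on X:
   - either mu = Lebesgue measure restricted to the compact interval [a,b];
   - or mu = counting measure restricted to {1,...,d}.
   Then H = L^2(X, mu) = L^2(R, mu). *)
Definition std_space (R : realType)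
  (mu : {measure set (measurableTypeR R) -> \bar R}) : Prop :=
  (exists a b : R, a < b /\
     forall A, measurable A -> mu A = lebesgue_measure (A `&` `[a, b]))
  \/
  (exists d : nat, (0 < d)%N /\
     forall A, measurable A ->
       mu A = counting (A `&` [set (k.+1)%:R | k in [set k : nat | (k < d)%N]])).

Section Hspace.
Variables (R : realType) (mu : {measure set (measurableTypeR R) -> \bar R}).

(* f is (a representative of) an element of H = L^2(mu) *)
Definition memL2 (f : R -> R) : Prop :=
  measurable_fun setT f /\ (\int[mu]_x ((f x) ^+ 2)%:E < +oo)%E.

Definition innerH (f g : R -> R) : R := fine (\int[mu]_x (f x * g x)%:E).

Definition normH (f : R -> R) : R := Num.sqrt (innerH f f).

Definition memL2ker (beta : R * R -> R) : Prop :=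
  measurable_fun setT beta /\
  (\int[mu]_y \int[mu]_x ((beta (x, y)) ^+ 2)%:E < +oo)%E.

Definition normker2 (beta : R * R -> R) : R :=
  fine (\int[mu]_y \int[mu]_x ((beta (x, y)) ^+ 2)%:E).

Definition kerop (beta : R * R -> R) (f : R -> R) : R -> R :=
  fun x => innerH (fun y => beta (x, y)) f.

(* sigma-algebra on H generated by the continuous linear functionals
   f |-> <f, h>_H  (h in H); for the separable Hilbert space H this is the
   Borel sigma-algebra. *)
Definition Hmeasurable : set (set (R -> R)) :=
  smallest (sigma_algebra setT)
    [set A | exists h B, memL2 h /\ measurable (B : set R) /\
             A = [set f | B (innerH f h)]].

End Hspace.

Definition is_metric (M : Type) (R : realType) (d : M -> M -> R) : Prop :=
  (forall a b, 0 <= d a b) /\ (forall a b, d a b = 0 <-> a = b) /\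
  (forall a b, d a b = d b a) /\ (forall a b c, d a c <= d a b + d b c).

Definition euclid_norm (R : realType) (n : nat) (v : 'I_n -> R) : R :=
  Num.sqrt (\sum_(i < n) v i ^+ 2).

Section RandomElements.
Variables (R : realType) (mu : {measure set (measurableTypeR R) -> \bar R}).
Variables (dO : measure_display) (Omega : measurableType dO)
  (P : probability Omega R).

Definition H_random_element (X : Omega -> R -> R) : Prop :=
  (forall w, memL2 mu (X w)) /\
  (forall A, Hmeasurable mu A -> measurable (X @^-1` A)).

Definition H_mean_zero (X : Omega -> R -> R) : Prop :=
  forall h, memL2 mu h -> (\int[P]_w (innerH mu (X w) h)%:E = 0)%E.

Definition H_independent (n : nat) (X : 'I_n -> Omega -> R -> R) : Prop :=
  forall A : 'I_n -> set (R -> R), (forall i, Hmeasurable mu (A i)) ->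
    P [set w | forall i, A i (X i w)] = (\prod_(i < n) P (X i @^-1` A i))%E.

End RandomElements.

(* Main.v *)
Require Import Defs.
From HB Require Import structures.
From mathcomp Require Import all_boot all_order all_algebra.
From mathcomp Require Import all_classical all_reals all_analysis.
From mathcomp Require Import ring lra measurable_realfun.
Import Order.TTheory GRing.Theory Num.Theory numFieldNormedType.Exports.
Local Open Scope classical_set_scope.
Local Open Scope ring_scope.

(** Projecting onto a convex set does not increase the distance to its points, so
    the error is at most the norm of [Y_1T - sum_j gamma_j Y_jT], which the model
    splits into kernel terms, covariate terms and the noise
    [eps_1 - sum_j gamma_j eps_j]. The first two are handled by the
    Cauchy-Schwarz inequality.

    For the noise, [cosh (sqrt u)] is convex and increasing in [u >= 0]. Applied to
    [u = |s + x|^2 <= |s|^2 + c^2 + 2 <s, x>] this bounds [cosh |s + x|] by a chord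
    that is affine in [<s, x>], hence [E cosh |s + X| <= cosh |s| cosh c] whenever
    [X] is centred with [|X| <= c]. Iterating over independent summands and using
    [cosh c <= exp (c^2 / 2)], Markov's inequality gives the sub-Gaussian tail with
    its factor 2 (Pinelis).

    The noise is reduced to finitely many real coordinates by orthonormal families
    of normalized indicators: the projections [P_m f] converge to [f] almost
    everywhere by Lebesgue differentiation, and Fatou's lemma then yields
    [|P_m f| -> |f|]. *)

Set Implicit Arguments.
Unset Strict Implicit.
Unset Printing Implicit Defensive.

(** * Hyperbolic functions *)

Section hyperbolic.
Context {R : realType}.
Implicit Types a b p t u v x y : R.

Definition cosh x : R := (expR x + expR (- x)) / 2.

Definition sinh x : R := (expR x - expR (- x)) / 2.

(* [sinhc 0 = 0] instead of the limit [1]. *)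
Definition sinhc x : R := sinh x / x.

Lemma cosh0 : cosh 0 = 1.
Proof. by rewrite /cosh oppr0 expR0; lra. Qed.

Lemma cosh_gt0 x : 0 < cosh x.
Proof. by rewrite /cosh divr_gt0// addr_gt0// expR_gt0. Qed.

Lemma cosh_ge0 x : 0 <= cosh x. Proof. exact: ltW (cosh_gt0 x). Qed.

Lemma coshN x : cosh (- x) = cosh x.
Proof. by rewrite /cosh opprK addrC. Qed.

Lemma sinhN x : sinh (- x) = - sinh x.
Proof. by rewrite /sinh opprK; lra. Qed.

Lemma sinh0 : sinh 0 = 0.
Proof. by rewrite /sinh oppr0 subrr mul0r. Qed.

Lemma coshD x y : cosh (x + y) = cosh x * cosh y + sinh x * sinh y.
Proof. by rewrite /cosh /sinh opprD !expRD; lra. Qed.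

Lemma normr_sinh_le_cosh x : `|sinh x| <= cosh x.
Proof.
rewrite /sinh /cosh ler_norml.
by have := expR_gt0 x; have := expR_gt0 (- x); move=> *; apply/andP; split; lra.
Qed.

Lemma sinhcMr x : sinhc x * x = sinh x.
Proof. by have [->|x0] := eqVneq x 0; rewrite ?mulr0 ?sinh0// divfK. Qed.

Lemma expR_le_2cosh x : expR x <= 2 * cosh x.
Proof. by rewrite /cosh mulrC divfK// lerDl expR_ge0. Qed.

Lemma cvg_series_cosh x :
  \sum_(k < n) (x ^+ 2) ^+ k / (k.*2)`!%:R @[n --> \oo] --> cosh x.
Proof.
have double_cvgy : (fun n : nat => n.*2) @ \oo --> \oo.
  move=> A [N _ NA]; exists N => // n /= Nn; apply: NA => /=.
  by rewrite (leq_trans Nn)// -addnn leq_addr.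
have expR_cvg y : series (exp_coeff y) n.*2 @[n --> \oo] --> expR y.
  exact: (cvg_comp _ _ double_cvgy (is_cvg_series_exp_coeff y)).
rewrite (_ : (fun n : nat => _) = (fun n : nat =>
  (series (exp_coeff x) n.*2 + series (exp_coeff (- x)) n.*2) / 2)).
  by apply: cvgMr_tmp; exact: cvgD.
apply/funext; elim=> [|n ih].
  by rewrite big_ord0 /series/= !big_geq// addr0 mul0r.
rewrite big_ord_recr/= ih doubleS /series/= !big_nat_recr//=.
rewrite /exp_coeff/= !(exprS _ n.*2) -!mul2n !exprM sqrrN.
set A := \big[_/_]_(_ <= _ < _) _; set B := \big[_/_]_(_ <= _ < _) _.
by set C := (_ / (2 * n)`!%:R); lra.
Qed.

Lemma ler_cosh_sqr x y : x ^+ 2 <= y ^+ 2 -> cosh x <= cosh y.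
Proof.
move=> xy; apply: (ler_cvg_to (cvg_series_cosh (x := x)) (cvg_series_cosh (x := y))).
apply: nearW => n; apply: ler_sum => k _; rewrite ler_wpM2r ?invr_ge0//.
by rewrite lerXn2r ?nnegrE ?sqr_ge0.
Qed.

Lemma ler_cosh : {in Num.nneg &, {homo cosh : x y / x <= y}}.
Proof. by move=> x y x0 y0 xy; rewrite ler_cosh_sqr// lerXn2r. Qed.

(* Termwise, as [2 ^ k * k! <= (2 k)!]. *)
Lemma cosh_le_expR x : cosh x <= expR (x ^+ 2 / 2).
Proof.
apply: (ler_cvg_to (cvg_series_cosh (x := x)) (is_cvg_series_exp_coeff (x ^+ 2 / 2))).
apply: nearW => n; rewrite /series/= big_mkord; apply: ler_sum => k _.
rewrite /exp_coeff/= expr_div_n -mulrA ler_wpM2l ?(exprn_ge0 _ (sqr_ge0 _))//.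
rewrite -invfM lef_pV2 ?posrE ?mulr_gt0 ?exprn_gt0 ?ltr0n ?fact_gt0//.
rewrite -natrX -natrM ler_nat.
elim: (k : nat) => // {k} k ih.
rewrite doubleS !factS expnS mulnACA leq_mul//; first by rewrite mul2n doubleS.
by rewrite (leq_trans ih)// leq_pmull.
Qed.

Lemma exprn_convex p u v k : 0 <= p <= 1 -> 0 <= u -> 0 <= v ->
  ((1 - p) * u + p * v) ^+ k <= (1 - p) * u ^+ k + p * v ^+ k.
Proof.
move=> /andP[p0 p1] u0 v0; elim: k => [|k ih]; first by rewrite !expr0; lra.
have q0 : 0 <= 1 - p by rewrite subr_ge0.
rewrite exprS (le_trans (ler_wpM2l _ ih)) ?addr_ge0 ?mulr_ge0//.
rewrite -subr_ge0 !exprS.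
rewrite (_ : _ - _ = p * (1 - p) * ((u - v) * (u ^+ k - v ^+ k))); last by ring.
apply: mulr_ge0; first exact: mulr_ge0.
have [uv|/ltW vu] := leP u v.
  by rewrite mulr_le0 ?subr_le0// lerXn2r.
by rewrite mulr_ge0 ?subr_ge0// lerXn2r.
Qed.

(* [cosh (sqrt u)] is a power series in [u] with nonnegative coefficients,
   hence convex and nondecreasing for [u >= 0]. *)
Lemma cosh_sqrt_convex p x y z : 0 <= p <= 1 ->
  z ^+ 2 <= (1 - p) * x ^+ 2 + p * y ^+ 2 ->
  cosh z <= (1 - p) * cosh x + p * cosh y.
Proof.
move=> p01 zxy; apply: (ler_cvg_to (cvg_series_cosh (x := z))).
  by apply: cvgD; apply: cvgMl_tmp; exact: cvg_series_cosh.
apply: nearW => n; rewrite !fctE/= !mulr_sumr -big_split/=; apply: ler_sum => k _.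
rewrite !mulrA -mulrDl ler_wpM2r ?invr_ge0//.
rewrite (le_trans _ (exprn_convex _ p01 _ _)) ?sqr_ge0//.
by rewrite lerXn2r ?nnegrE ?(le_trans _ zxy) ?sqr_ge0.
Qed.

(* The chord of [cosh (sqrt u)] between [u = (a - b) ^ 2] and [u = (a + b) ^ 2]. *)
Lemma cosh_chord a b t x : `|t| <= a * b -> x ^+ 2 <= a ^+ 2 + b ^+ 2 + 2 * t ->
  cosh x <= cosh a * cosh b + t * sinhc a * sinhc b.
Proof.
move=> tab xE; have [ab0|ab0] := eqVneq (a * b) 0.
  move: tab xE; rewrite ab0 normr_le0 => /eqP ->.
  rewrite mulr0 addr0 !mul0r addr0 => xE.
  have sinh_ab : sinh a * sinh b = 0.
    by move/eqP: ab0; rewrite mulf_eq0 => /orP[]/eqP ->; rewrite sinh0 ?mul0r ?mulr0.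
  rewrite -[leRHS]addr0 -sinh_ab -coshD ler_cosh_sqr//.
  by rewrite sqrrD ab0 mul0rn addr0.
have [a0 b0] : a != 0 /\ b != 0 by apply/andP; rewrite -negb_or -mulf_eq0.
have abp : 0 < a * b by rewrite lt_def ab0 (le_trans _ tab).
pose p := (1 + t / (a * b)) / 2.
have p01 : 0 <= p <= 1.
  have : `|t / (a * b)| <= 1.
    by rewrite normrM normfV (gtr0_norm abp) ler_pdivrMr// mul1r.
  by rewrite ler_norml /p => /andP[? ?]; apply/andP; split; lra.
have tE : t = (2 * p - 1) * (a * b) by rewrite /p; field; rewrite a0 b0.
have chordE : (1 - p) * (a - b) ^+ 2 + p * (a + b) ^+ 2 = a ^+ 2 + b ^+ 2 + 2 * t.
  by rewrite tE; ring.
rewrite -chordE in xE; rewrite (le_trans (cosh_sqrt_convex p01 xE))//.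
rewrite !coshD coshN sinhN [leLHS](_ : _ = cosh a * cosh b + t * sinhc a * sinhc b)//.
by rewrite tE /sinhc; field; rewrite a0 b0.
Qed.

Lemma measurable_cosh : measurable_fun [set: R] cosh.
Proof.
apply: measurable_funM => //; apply: measurable_funD => //.
by apply: measurableT_comp; [exact: measurable_expR|exact: oppr_measurable].
Qed.

Lemma measurable_sinh : measurable_fun [set: R] sinh.
Proof.
apply: measurable_funM => //; apply: measurable_funB => //.
by apply: measurableT_comp; [exact: measurable_expR|exact: oppr_measurable].
Qed.

End hyperbolic.

Lemma measurable_sqrt {R : realType} : measurable_fun [set: R] (@Num.sqrt R).
Proof. by apply: continuous_measurable_fun; exact: sqrt_continuous. Qed.

Lemma measurable_invr {R : realType} : measurable_fun [set: R] (@GRing.inv R).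
Proof.
rewrite (_ : @GRing.inv R = (fun x => x * (x ^+ 2) `^ (-1))).
  apply: measurable_funM => //.
  by apply: (measurableT_comp (measurable_powR _)); exact: exprn_measurable.
apply/funext => x; rewrite powR_inv1 ?sqr_ge0//.
by have [->|x0] := eqVneq x 0; [rewrite invr0 mul0r|field].
Qed.

Lemma measurable_sinhc {R : realType} : measurable_fun [set: R] (@sinhc R).
Proof. by apply: measurable_funM; [exact: measurable_sinh|exact: measurable_invr]. Qed.

(** * The Euclidean norm *)

Lemma discriminant_le {R : realFieldType} (A B C : R) : 0 <= B ->
  (forall t, 0 <= A + 2 * t * C + t ^+ 2 * B) -> C ^+ 2 <= A * B.
Proof.
move=> B0 quad_ge0; pose p := Poly [:: A; 2 * C; B].
have := @deg_le2_poly_delta_ge0 R p (size_Poly _); rewrite !coefE/=.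
move=> /(_ B0) delta_le0; suff : (2 * C) ^+ 2 - 4 * B * A <= 0.
  by rewrite exprMn; lra.
apply: delta_le0 => t; rewrite horner_Poly/= mul0r add0r.
by have := quad_ge0 t; congr (0 <= _); ring.
Qed.

Section euclid_norm.
Context {R : realType} {n : nat}.
Implicit Types u v : 'I_n -> R.

Lemma euclid_norm_ge0 v : 0 <= euclid_norm v. Proof. exact: sqrtr_ge0. Qed.

Lemma sqr_euclid_norm v : euclid_norm v ^+ 2 = \sum_(i < n) v i ^+ 2.
Proof. by rewrite sqr_sqrtr// sumr_ge0// => i _; exact: sqr_ge0. Qed.

Lemma euclid_normZ (l : R) v : euclid_norm (fun i => l * v i) = `|l| * euclid_norm v.
Proof.
rewrite /euclid_norm; under eq_bigr do rewrite exprMn.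
by rewrite -mulr_sumr sqrtrM ?sqr_ge0// sqrtr_sqr.
Qed.

Lemma ler_euclid_norm u v : (forall i, `|u i| <= v i) -> euclid_norm u <= euclid_norm v.
Proof.
move=> uv; rewrite ler_wsqrtr// ler_sum// => i _.
by rewrite -(real_normK (num_real (u i))) lerXn2r ?nnegrE// (le_trans _ (uv i)).
Qed.

Lemma normr_le_euclid_norm v i : `|v i| <= euclid_norm v.
Proof.
rewrite -sqrtr_sqr ler_wsqrtr// (bigD1 i)//= lerDl sumr_ge0// => j _.
exact: sqr_ge0.
Qed.

Lemma euclid_cauchy_schwarz u v :
  `|\sum_(i < n) u i * v i| <= euclid_norm u * euclid_norm v.
Proof.
rewrite -sqrtr_sqr -sqrtrM ?sumr_ge0//; last by move=> i _; exact: sqr_ge0.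
rewrite ler_wsqrtr//; apply: discriminant_le => [|t].
  by apply: sumr_ge0 => i _; exact: sqr_ge0.
rewrite !mulr_sumr -!big_split/=; apply: sumr_ge0 => i _.
by rewrite (_ : _ + _ = (u i + t * v i) ^+ 2) ?sqr_ge0//; ring.
Qed.

Lemma measurable_euclid_norm {d} {T : measurableType d} (f : 'I_n -> T -> R) :
  (forall i, measurable_fun setT (f i)) ->
  measurable_fun setT (fun w => euclid_norm (f ^~ w)).
Proof.
move=> mf; apply: (measurableT_comp measurable_sqrt).
by apply: measurable_sum => i; exact: measurable_funX.
Qed.

(* The gradient of [cosh \o euclid_norm]. *)
Definition grad_cosh u (i : 'I_n) : R := u i * sinhc (euclid_norm u).

Lemma normr_grad_cosh u i : `|grad_cosh u i| <= cosh (euclid_norm u).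
Proof.
rewrite (le_trans _ (normr_sinh_le_cosh _))// -sinhcMr /grad_cosh !normrM mulrC.
by rewrite ler_wpM2l// (ger0_norm (euclid_norm_ge0 _)) normr_le_euclid_norm.
Qed.

Lemma cosh_euclid_normD u v (b : R) : euclid_norm v <= b ->
  cosh (euclid_norm (fun i => u i + v i)) <=
  cosh b * cosh (euclid_norm u) + sinhc b * \sum_(i < n) v i * grad_cosh u i.
Proof.
move=> vb; pose t := \sum_(i < n) u i * v i.
have tE : sinhc b * \sum_(i < n) v i * grad_cosh u i =
    t * sinhc (euclid_norm u) * sinhc b.
  rewrite mulrC !mulr_suml; apply: eq_bigr => i _.
  by rewrite /grad_cosh mulrA (mulrC (v i)).
rewrite tE mulrC; apply: cosh_chord.
  by rewrite (le_trans (euclid_cauchy_schwarz _ _))// ler_wpM2l ?euclid_norm_ge0.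
have -> : euclid_norm (fun i => u i + v i) ^+ 2 =
    euclid_norm u ^+ 2 + euclid_norm v ^+ 2 + 2 * t.
  rewrite !sqr_euclid_norm mulr_sumr -!big_split/=; apply: eq_bigr => i _; ring.
rewrite lerD2r lerD2l lerXn2r ?nnegrE ?euclid_norm_ge0//.
exact: le_trans (euclid_norm_ge0 v) vb.
Qed.

End euclid_norm.

(** * Integration and independence *)

Lemma measurable_preimage {d1 d2} {T1 : measurableType d1} {T2 : measurableType d2}
    (f : T1 -> T2) (B : set T2) :
  measurable_fun setT f -> measurable B -> measurable (f @^-1` B).
Proof. by move=> mf mB; rewrite -[X in measurable X]setTI; exact: mf. Qed.

Section integration.
Context {d} {T : measurableType d} {R : realType} (mu : {measure set T -> \bar R}).
Implicit Types f g : T -> R.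

Lemma ae_imply (A B : T -> Prop) : (forall x, A x -> B x) ->
  {ae mu, forall x, A x} -> {ae mu, forall x, B x}.
Proof. by move=> AB; apply: filterS => x; exact: AB. Qed.

Lemma ae_imply2 (A B C : T -> Prop) : (forall x, A x -> B x -> C x) ->
  {ae mu, forall x, A x} -> {ae mu, forall x, B x} -> {ae mu, forall x, C x}.
Proof. by move=> ABC; apply: filterS2 => x; exact: ABC. Qed.

Lemma ae_forall (I : finType) (A : I -> T -> Prop) :
  (forall i, {ae mu, forall x, A i x}) -> {ae mu, forall x, forall i, A i x}.
Proof. exact: filter_forall. Qed.

Lemma Rintegral_sum (I : Type) (s : seq I) (f : I -> T -> R) :
  (forall i, mu.-integrable setT (EFin \o f i)) ->
  \int[mu]_x (\sum_(i <- s) f i x) = \sum_(i <- s) \int[mu]_x f i x.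
Proof.
move=> fi; rewrite /Rintegral.
under eq_integral do rewrite -sumEFin.
by rewrite integral_sum// sum_fine// => i _; apply: integrable_fin_num => //; exact: fi.
Qed.

Lemma integrable_sumr (I : Type) (s : seq I) (f : I -> T -> R) :
  (forall i, mu.-integrable setT (EFin \o f i)) ->
  mu.-integrable setT (EFin \o (fun x => \sum_(i <- s) f i x)).
Proof.
move=> fi; rewrite (_ : EFin \o _ = (fun x => \sum_(i <- s) (EFin \o f i) x)%E).
  by apply: integrable_sum => // i _; exact: fi.
by apply/funext => x; rewrite /= sumEFin.
Qed.

Lemma ae_le_Rintegral f g :
  mu.-integrable setT (EFin \o f) -> mu.-integrable setT (EFin \o g) ->
  {ae mu, forall x, f x <= g x} -> \int[mu]_x f x <= \int[mu]_x g x.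
Proof.
move=> fi gi fg; rewrite -subr_ge0 -RintegralB//.
have /measurable_EFinP mf := measurable_int _ fi.
have /measurable_EFinP mg := measurable_int _ gi.
have mgf : measurable_fun setT (fun x => g x - f x) by exact: measurable_funB.
have -> : \int[mu]_x (g x - f x) = \int[mu]_x `|g x - f x|.
  congr fine; apply: ae_eq_integral => //; first exact/measurable_EFinP.
    by apply/measurable_EFinP; exact: measurableT_comp.
  by apply: ae_imply fg => x fgx _; rewrite /= ger0_norm// subr_ge0.
by apply: Rintegral_ge0.
Qed.

End integration.

Lemma ae_bounded_integrable {d} {T : measurableType d} {R : realType}
    (mu : {finite_measure set T -> \bar R}) (f : T -> R) (M : R) :
  measurable_fun setT f -> {ae mu, forall x, `|f x| <= M} ->
  mu.-integrable setT (EFin \o f).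
Proof.
move=> mf fM; apply/integrableP; split; first exact/measurable_EFinP.
apply: (@le_lt_trans _ _ ((`|M|)%:E * mu setT)%E); last first.
  by rewrite lte_mul_pinfty// ?lee_fin// fin_num_fun_lty//; exact: fin_num_measure.
apply: integral_le_bound => //; first exact/measurable_EFinP.
by apply: ae_imply fM => x fM _; rewrite lee_fin (le_trans fM)// ler_norm.
Qed.

Lemma ae_le_ge0 {d} {T : measurableType d} {R : realType} (P : probability T R)
    (f : T -> R) (s : R) :
  (forall w, 0 <= f w) -> {ae P, forall w, f w <= s} -> 0 <= s.
Proof.
have P_gt0 : (0 < P setT)%E by rewrite probability_setT.
move=> f0 /(@filter_ex _ _ (ae_properfilter_algebraOfSetsType P_gt0)) [w].
exact: le_trans.
Qed.

Lemma ae_fatou {d} {T : measurableType d} {R : realType}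
    (mu : {measure set T -> \bar R}) (f_ : (T -> \bar R)^nat) (f : T -> \bar R) :
  (forall n, measurable_fun setT (f_ n)) -> (forall n x, (0 <= f_ n x)%E) ->
  measurable_fun setT f ->
  {ae mu, forall x, f_ n x @[n --> \oo] --> f x} ->
  (\int[mu]_x f x <= limn_einf (fun n => \int[mu]_x f_ n x))%E.
Proof.
move=> mf_ f_0 mf f_f.
apply: le_trans (fatou mu measurableT mf_ (fun n x _ => f_0 n x)).
rewrite (ae_eq_integral (fun x => limn_einf (f_ ^~ x)))//.
  apply: measurableT_comp => //; apply: measurable_fun_limn_esup => n.
  exact: measurableT_comp.
by apply: ae_imply f_f => x f_f _; rewrite (cvg_limn_einf_sup f_f).1.
Qed.

Lemma measurable_gt {d} {T : measurableType d} {R : realType} (f : T -> R) (r : R) :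
  measurable_fun setT f -> measurable [set x | r < f x].
Proof.
move=> mf; rewrite (_ : [set x | _] = f @^-1` `]r, +oo[%classic).
  exact: measurable_preimage.
by apply/seteqP; split=> x /=; rewrite in_itv/= andbT.
Qed.

Lemma measure_gt_lim_le {d} {T : measurableType d} {R : realType}
    (mu : {measure set T -> \bar R}) (f_ : (T -> R)^nat) (f : T -> R) (r : R)
    (c : \bar R) :
  (forall n, measurable_fun setT (f_ n)) -> (forall x, f_ n x @[n --> \oo] --> f x) ->
  (forall n, mu [set x | (r < f_ n x)%R] <= c)%E -> (mu [set x | (r < f x)%R] <= c)%E.
Proof.
move=> mf_ f_f muA; pose A n := [set x | r < f_ n x].
have mA n : measurable (A n) by exact: measurable_gt.
pose D n := \bigcap_(m in [set m | (n <= m)%N]) A m.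
have mD n : measurable (D n) by apply: bigcap_measurable => //; exists n => /=.
have mUD : measurable (\bigcup_n D n) by exact: bigcupT_measurable.
have mf : measurable_fun setT f by exact: (measurable_fun_cvg mf_ (fun x _ => f_f x)).
have ndD : nondecreasing_seq D.
  move=> n m nm; apply/subsetPset => x Dx k /= mk; apply: Dx.
  exact: leq_trans mk.
apply: (@le_trans _ _ (mu (\bigcup_n D n))).
  apply: le_measure; [by rewrite inE; exact: measurable_gt|by rewrite inE|].
  by move=> x rf; have [n _ nP] := cvgr_gt _ (f_f x) _ rf; exists n.
have cvg_muD := nondecreasing_cvg_mu (mu := mu) mD mUD ndD.
rewrite -(cvg_lim _ cvg_muD)//; apply: lime_le.
  by apply/cvg_ex; eexists; exact: cvg_muD.
apply: nearW => n; apply: le_trans (muA n); apply: le_measure.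
- by rewrite inE.
- by rewrite inE; exact: mA.
- by move=> x /(_ n (leqnn n)).
Qed.

Section independent_pair.
Context {d} {Omega : measurableType d} {R : realType} (P : probability Omega R).
Variables U V : Omega -> R.
Hypothesis measurable_U : measurable_fun setT U.
Hypothesis measurable_V : measurable_fun setT V.
Hypothesis indepUV : forall A B : set R, measurable A -> measurable B ->
  P (U @^-1` A `&` V @^-1` B) = (P (U @^-1` A) * P (V @^-1` B))%E.
Hypothesis integrable_U : P.-integrable setT (EFin \o U).
Hypothesis integrable_V : P.-integrable setT (EFin \o V).

Let rvU : {RV P >-> R} := HB.pack U (isMeasurableFun.Build _ _ _ _ U measurable_U).
Let rvV : {RV P >-> R} := HB.pack V (isMeasurableFun.Build _ _ _ _ V measurable_V).
Let lawU := distribution P rvU.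
Let lawV := distribution P rvV.

Let UV (w : Omega) : R * R := (U w, V w).
Let measurable_UV : measurable_fun setT UV. Proof. exact: measurable_fun_pair. Qed.
Let rvUV : {RV P >-> (R * R)%type} :=
  HB.pack UV (isMeasurableFun.Build _ _ _ _ UV measurable_UV).

Let law_UV X : measurable X -> (lawU \x lawV)%E X = distribution P rvUV X.
Proof.
apply: product_measure_unique => A B mA mB.
by rewrite /lawU /lawV /distribution/= /pushforward/= -indepUV.
Qed.

Let mulr_pair (z : R * R) : \bar R := (z.1 * z.2)%:E.

Let measurable_mulr_pair : measurable_fun setT mulr_pair.
Proof. by apply/measurable_EFinP; exact: measurable_funM. Qed.

Let integral_abse_law (W : {RV P >-> R}) :
  (\int[distribution P W]_x `|x%:E| = \int[P]_w `|(W w)%:E|)%E.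
Proof.
rewrite (ge0_integral_distribution W (f := fun x => `|x%:E|%E))//.
by apply: measurableT_comp => //; exact/measurable_EFinP.
Qed.

Let integrable_law (W : {RV P >-> R}) : P.-integrable setT (EFin \o W) ->
  (distribution P W).-integrable setT EFin.
Proof.
move=> /integrableP[_ W_lty]; apply/integrableP; split; first exact/measurable_EFinP.
by rewrite integral_abse_law.
Qed.

Let integral_law (W : {RV P >-> R}) : P.-integrable setT (EFin \o W) ->
  (\int[distribution P W]_x x%:E = \int[P]_w (W w)%:E)%E.
Proof.
by move=> iW; rewrite (integral_distribution (X := W) (f := EFin)).
Qed.

Let integrable_lawU : lawU.-integrable setT EFin.
Proof. exact: (@integrable_law rvU). Qed.

Let integrable_lawV : lawV.-integrable setT EFin.
Proof. exact: (@integrable_law rvV). Qed.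

Let integrable_mulr_pair : (lawU \x lawV)%E.-integrable setT mulr_pair.
Proof.
have [_ U_lty] := integrableP _ _ _ integrable_lawU.
have [_ V_lty] := integrableP _ _ _ integrable_lawV.
have m_abse : measurable_fun [set: R] (fun x : R => `|x%:E|%E).
  exact: (measurable_int _ (integrable_abse integrable_lawU)).
apply/integrableP; split => //; rewrite fubini_tonelli1//; last exact: measurableT_comp.
rewrite /fubini_F (eq_integral (fun x : R => `|x%:E| * \int[lawV]_y `|y%:E|)%E).
  rewrite ge0_integralZr ?integral_ge0//.
  by rewrite lte_mul_pinfty ?integral_ge0// ge0_fin_numE ?integral_ge0.
move=> x _; rewrite -ge0_integralZl//.
by apply: eq_integral => y _; rewrite /mulr_pair/= normrM EFinM.
Qed.

Lemma integrableM_indep : P.-integrable setT (EFin \o (fun w => U w * V w)).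
Proof.
apply/integrableP; split; first by apply/measurable_EFinP; exact: measurable_funM.
have /integrableP[_] := integrable_mulr_pair.
rewrite (eq_measure_integral (distribution P rvUV)); last first.
  by move=> A mA _; exact: law_UV.
by rewrite ge0_integral_distribution//; exact: measurableT_comp.
Qed.

Lemma RintegralM_indep : \int[P]_w (U w * V w) = (\int[P]_w U w) * \int[P]_w V w.
Proof.
rewrite /Rintegral -fineM; last 2 first.
- exact: integrable_fin_num.
- exact: integrable_fin_num.
congr fine; rewrite -(integral_law (W := rvU))// -(integral_law (W := rvV))//.
transitivity (\int[distribution P rvUV]_z mulr_pair z)%E.
  by rewrite integral_distribution//; exact: integrableM_indep.
rewrite (eq_measure_integral (lawU \x lawV)%E); last first.
  by move=> A mA _; exact/esym/law_UV.
rewrite -integral12_prod_meas1// /fubini_F.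
rewrite (eq_integral (fun x : R => x%:E * \int[lawV]_y y%:E)%E).
  rewrite -(fineK (integrable_fin_num measurableT integrable_lawV)).
  exact: integralZr.
by move=> x _; rewrite -integralZl.
Qed.

End independent_pair.

Section mutual_independence.
Context {d} {Omega : measurableType d} {R : realType} (P : probability Omega R).
Context {d'} {T : measurableType d'} {n : nat}.
Implicit Type X : 'I_n -> Omega -> T.

Definition mutually_independent X : Prop :=
  forall A : 'I_n -> set T, (forall i, measurable (A i)) ->
    P [set w | forall i, A i (X i w)] = (\prod_(i < n) P (X i @^-1` A i))%E.

Definition past_cylinders X (j : nat) : set (set Omega) :=
  [set C | exists A : 'I_n -> set T, [/\ forall i, measurable (A i),
    forall i : 'I_n, (j <= i)%N -> A i = setT & C = [set w | forall i, A i (X i w)]]].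

Lemma past_cylinders_measurable X j : (forall i, measurable_fun setT (X i)) ->
  past_cylinders X j `<=` measurable.
Proof.
move=> mX _ [A [mA _ ->]].
rewrite (_ : [set w | _] = \bigcap_i (X i @^-1` A i)).
  by apply: fin_bigcap_measurable => // i _; exact: measurable_preimage.
by apply/seteqP; split=> w /= Aw i; [move=> _|]; exact: Aw.
Qed.

Lemma past_cylinders_setI_closed X j : setI_closed (past_cylinders X j).
Proof.
move=> _ _ [A [mA TA ->]] [B [mB TB ->]]; exists (fun i => A i `&` B i); split.
- by move=> i; exact: measurableI.
- by move=> i ji; rewrite TA// TB// setIT.
- apply/seteqP; split=> w /=; first by move=> [Aw Bw] i.
  by move=> ABw; split=> i; case: (ABw i).
Qed.

Lemma measurable_past X (i : 'I_n) j : (i < j)%N ->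
  measurable_fun [set: g_sigma_algebraType (past_cylinders X j)] (X i : Omega -> T).
Proof.
move=> ij _ B mB; rewrite setTI; apply: sub_sigma_algebra.
exists (fun l => if l == i then B else setT); split.
- by move=> l; case: eqP.
- by move=> l jl; case: eqP => // li; move: jl; rewrite li leqNgt ij.
- apply/seteqP; split=> [w Bw l|w /(_ i)] /=; last by rewrite eqxx.
  by case: eqP => // ->.
Qed.

Lemma measurable_fun_past {d2} {T2 : measurableType d2} X j (f : Omega -> T2) :
  (forall i, measurable_fun setT (X i)) ->
  measurable_fun [set: g_sigma_algebraType (past_cylinders X j)] (f : Omega -> T2) ->
  measurable_fun setT f.
Proof.
move=> mX mf _ B mB; have := mf measurableT B mB; move: (_ `&` _).
apply: smallest_sub; first exact: sigma_algebra_measurable.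
exact: past_cylinders_measurable.
Qed.

Lemma mutually_independent_past X (j : 'I_n) (B : set T) (C : set Omega) :
  (forall i, measurable_fun setT (X i)) -> mutually_independent X ->
  measurable B -> <<s past_cylinders X j >> C ->
  P (X j @^-1` B `&` C) = (P (X j @^-1` B) * P C)%E.
Proof.
move=> mX indepX mB sC; set D := X j @^-1` B.
have mD : measurable D by exact: measurable_preimage.
have PD_fin : P D \is a fin_num by exact: fin_num_measure.
have PD0 : 0 <= fine (P D) by exact: fine_ge0.
transitivity (mscale (NngNum PD0) P C); last by rewrite /mscale/= fineK.
rewrite setIC -[LHS]/(mrestr P mD C).
apply: (g_sigma_algebra_measure_unique (past_cylinders X j)
  (past_cylinders_measurable mX) (fun=> setT)) => //.
- move=> _; exists (fun=> setT); split=> //.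
  by apply/seteqP; split=> // w _ i.
- by rewrite bigcup_const.
- exact: past_cylinders_setI_closed.
- move=> _ [A [mA TA ->]].
  rewrite -[LHS]/(P (_ `&` D)) -[RHS]/((fine (P D))%:E * P _)%E fineK//.
  rewrite indepX// (bigD1 j)//= TA// preimage_setT probability_setT mul1e.
  pose A' i := if i == j then B else A i.
  rewrite (_ : _ `&` _ = [set w | forall i, A' i (X i w)]); last first.
    apply/seteqP; split=> w /=.
      by move=> [Aw Bw] i; rewrite /A'; case: eqP => [->|].
    move=> A'w; split=> [i|]; last by have := A'w j; rewrite /A' eqxx.
    by have := A'w i; rewrite /A'; case: eqP => // ->; rewrite TA.
  rewrite indepX; last by move=> i; rewrite /A'; case: eqP.
  rewrite (bigD1 j)//= /A' eqxx; congr (_ * _)%E.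
  by apply: eq_bigr => i /negPf ->.
- move=> _; rewrite -[ltLHS]/(P (setT `&` D)) setTI.
  by rewrite (le_lt_trans (probability_le1 _ _))// ltry.
Qed.

End mutual_independence.

Lemma mutually_independent_comp {d d1 d2} {Omega : measurableType d}
    {T1 : measurableType d1} {T2 : measurableType d2} {R : realType}
    (P : probability Omega R) (n : nat) (X : 'I_n -> Omega -> T1)
    (f : 'I_n -> T1 -> T2) :
  mutually_independent P X -> (forall i, measurable_fun setT (f i)) ->
  mutually_independent P (fun i => f i \o X i).
Proof.
move=> indepX mf A mA; rewrite -(indepX (fun i => f i @^-1` A i))// => i.
exact: measurable_preimage.
Qed.

(** * Pinelis' inequality *)

Section cosh_martingale.
Context {d} {Omega : measurableType d} {R : realType} (P : probability Omega R).
Variables (n K : nat) (X : 'I_n -> Omega -> K.-tuple R) (c : 'I_n -> R).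
Hypothesis measurable_X : forall i, measurable_fun setT (X i).
Hypothesis indepX : mutually_independent P X.
Hypothesis meanX : forall i k, \int[P]_w tnth (X i w) k = 0.
Hypothesis boundX : forall i, {ae P, forall w, euclid_norm (tnth (X i w)) <= c i}.

Let S (j : nat) (w : Omega) (k : 'I_K) : R := \sum_(i < n | (i < j)%N) tnth (X i w) k.

Let S_recr (j : 'I_n) w : S j.+1 w = (fun k => S j w k + tnth (X j w) k).
Proof.
apply/funext => k; rewrite /S (bigD1 j)//= addrC; congr (_ + _); apply: eq_bigl => i.
by rewrite ltnS [(i < j)%N]ltn_neqAle andbC.
Qed.

Let M : R := euclid_norm (fun _ : 'I_K => \sum_(i < n) c i).

Let c_ge0 i : 0 <= c i.
Proof. exact: ae_le_ge0 (fun w => euclid_norm_ge0 _) (boundX i). Qed.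

Let boundS j : {ae P, forall w, euclid_norm (S j w) <= M}.
Proof.
apply: ae_imply (ae_forall boundX) => w Xc; apply: ler_euclid_norm => k.
rewrite (le_trans (ler_norm_sum _ _ _))// big_mkcond/= ler_sum// => i _.
by case: ifP => _; [exact: le_trans (normr_le_euclid_norm _ k) (Xc i)|exact: c_ge0].
Qed.

Local Notation past j := (g_sigma_algebraType (past_cylinders X j)).

Let measurable_S_past j k :
  measurable_fun [set: past j] (S j ^~ k : Omega -> R).
Proof.
rewrite (_ : S j ^~ k = fun w => \sum_(i < n) if (i < j)%N then tnth (X i w) k else 0).
  apply: measurable_sum => i; case: (ltnP i j) => ij; last exact: measurable_cst.
  exact: (measurableT_comp (measurable_tnth k) (measurable_past (X := X) ij)).
by apply/funext => w; rewrite /S big_mkcond.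
Qed.

Let measurable_S j k : measurable_fun setT (S j ^~ k).
Proof. exact: (measurable_fun_past measurable_X (@measurable_S_past j k)). Qed.

Let measurable_grad_past j k : measurable_fun [set: past j]
  ((fun w => grad_cosh (S j w) k) : Omega -> R).
Proof.
apply: measurable_funM => //; apply: (measurableT_comp measurable_sinhc).
exact: (@measurable_euclid_norm _ _ _ (past j) (fun k w => S j w k)).
Qed.

Let measurable_grad j k : measurable_fun setT (fun w => grad_cosh (S j w) k).
Proof. exact: (measurable_fun_past measurable_X (@measurable_grad_past j k)). Qed.

Let measurable_coord i k : measurable_fun setT (fun w => tnth (X i w) k).
Proof. exact: (measurableT_comp (measurable_tnth k)). Qed.

Let integrable_coord i k : P.-integrable setT (EFin \o (fun w => tnth (X i w) k)).
Proof.
apply: (@ae_bounded_integrable _ _ _ P _ (c i)) => //.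
by apply: ae_imply (boundX i) => w; exact: le_trans (normr_le_euclid_norm _ _).
Qed.

Let cosh_boundS j : {ae P, forall w, cosh (euclid_norm (S j w)) <= cosh M}.
Proof.
by apply: ae_imply (boundS j) => w ?; rewrite ler_cosh ?nnegrE ?euclid_norm_ge0.
Qed.

Let integrable_grad j k : P.-integrable setT (EFin \o (fun w => grad_cosh (S j w) k)).
Proof.
apply: (@ae_bounded_integrable _ _ _ P _ (cosh M)) => //.
by apply: ae_imply (cosh_boundS j) => w; exact: le_trans (normr_grad_cosh _ _).
Qed.

Let integrable_cosh j :
  P.-integrable setT (EFin \o (fun w => cosh (euclid_norm (S j w)))).
Proof.
apply: (@ae_bounded_integrable _ _ _ P _ (cosh M)).
  apply: (measurableT_comp measurable_cosh).
  exact: (measurable_euclid_norm (f := fun k w => S j w k)).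
by apply: ae_imply (cosh_boundS j) => w; rewrite ger0_norm ?cosh_ge0.
Qed.

Let indep_coord_grad (j : 'I_n) k (A B : set R) : measurable A -> measurable B ->
  P ((fun w => tnth (X j w) k) @^-1` A `&` (fun w => grad_cosh (S j w) k) @^-1` B) =
  (P ((fun w => tnth (X j w) k) @^-1` A) *
   P ((fun w => grad_cosh (S j w) k) @^-1` B))%E.
Proof.
move=> mA mB; apply: (mutually_independent_past (B := (@tnth _ R ^~ k) @^-1` A)) => //.
  exact: measurable_preimage (measurable_tnth k) mA.
exact: measurable_preimage (@measurable_grad_past j k) mB.
Qed.

Let integrable_increment (j : 'I_n) k :
  P.-integrable setT (EFin \o (fun w => tnth (X j w) k * grad_cosh (S j w) k)).
Proof. by apply: integrableM_indep => // A B; exact: indep_coord_grad. Qed.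

Let Rintegral_increment (j : 'I_n) k :
  \int[P]_w (tnth (X j w) k * grad_cosh (S j w) k) = 0.
Proof.
rewrite RintegralM_indep ?meanX ?mul0r// => A B; exact: indep_coord_grad.
Qed.

Let Rintegral_cosh_recr (j : 'I_n) : \int[P]_w cosh (euclid_norm (S j.+1 w)) <=
  cosh (c j) * \int[P]_w cosh (euclid_norm (S j w)).
Proof.
pose increment w := \sum_(k < K) tnth (X j w) k * grad_cosh (S j w) k.
have i_inc : P.-integrable setT (EFin \o increment) by exact: integrable_sumr.
have i_inc_scaled : P.-integrable setT (EFin \o (fun w => sinhc (c j) * increment w)).
  exact: (integrableZl measurableT _ i_inc).
have i_cosh_scaled :
    P.-integrable setT (EFin \o (fun w => cosh (c j) * cosh (euclid_norm (S j w)))).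
  exact: (integrableZl measurableT _ (integrable_cosh j)).
have -> : cosh (c j) * \int[P]_w cosh (euclid_norm (S j w)) =
    \int[P]_w (cosh (c j) * cosh (euclid_norm (S j w)) + sinhc (c j) * increment w).
  have mean_inc : \int[P]_w increment w = 0.
    rewrite Rintegral_sum; last exact: integrable_increment.
    by rewrite big1// => k _; exact: Rintegral_increment.
  by rewrite RintegralD// !RintegralZl// mean_inc mulr0 addr0.
apply: ae_le_Rintegral => //; first exact: integrableD i_cosh_scaled i_inc_scaled.
by apply: ae_imply (boundX j) => w Xc; rewrite S_recr; exact: cosh_euclid_normD.
Qed.

Let Rintegral_cosh_prod (j : nat) : (j <= n)%N ->
  \int[P]_w cosh (euclid_norm (S j w)) <= \prod_(i < n | (i < j)%N) cosh (c i).
Proof.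
elim: j => [_|j ih jn].
  rewrite (_ : (fun w => _) = (fun=> 1)).
    by rewrite Rintegral_cst//= mul1r probability_setT/= big1.
  apply/funext => w; rewrite /euclid_norm big1 ?sqrtr0 ?cosh0// => k _.
  by rewrite /S big1 ?expr0n.
rewrite (le_trans (Rintegral_cosh_recr (Ordinal jn)))// (bigD1 (Ordinal jn))//=.
rewrite ler_wpM2l ?cosh_ge0// (le_trans (ih (ltnW jn)))//.
rewrite [leRHS](eq_bigl (fun i : 'I_n => (i < j)%N))// => i.
by rewrite ltnS [(i < j)%N]ltn_neqAle andbC -val_eqE.
Qed.

Lemma expectation_cosh_norm_sum :
  ('E_P[fun w => cosh (euclid_norm (fun k => (\sum_(i < n) tnth (X i w) k)%R))] <=
   (expR (euclid_norm c ^+ 2 / 2))%:E)%E.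
Proof.
rewrite (_ : (fun w => _) = (fun w => cosh (euclid_norm (S n w)))); last first.
  apply/funext => w; congr (cosh (euclid_norm _)); apply/funext => k.
  by apply: eq_bigl => i; rewrite ltn_ord.
have cosh_fin_num := integrable_fin_num measurableT (@integrable_cosh n).
rewrite unlock -[leLHS](fineK cosh_fin_num) lee_fin.
rewrite (le_trans (Rintegral_cosh_prod (leqnn n)))//.
rewrite (eq_bigl predT); last by move=> i; rewrite ltn_ord.
rewrite sqr_euclid_norm mulr_suml expR_sum; apply: ler_prod => i _.
by rewrite cosh_ge0/= cosh_le_expR.
Qed.

End cosh_martingale.

Section pinelis.
Context {d} {Omega : measurableType d} {R : realType} (P : probability Omega R).
Variables (n K : nat) (X : 'I_n -> Omega -> K.-tuple R) (c : 'I_n -> R).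
Hypothesis measurable_X : forall i, measurable_fun setT (X i).
Hypothesis indepX : mutually_independent P X.
Hypothesis meanX : forall i k, \int[P]_w tnth (X i w) k = 0.
Hypothesis boundX : forall i, {ae P, forall w, euclid_norm (tnth (X i w)) <= c i}.

Local Notation N w := (euclid_norm (fun k => \sum_(i < n) tnth (X i w) k)).

Let measurable_N : measurable_fun setT (fun w => N w).
Proof.
apply: (measurable_euclid_norm (f := fun k w => \sum_(i < n) tnth (X i w) k)) => k.
by apply: measurable_sum => i; exact: (measurableT_comp (measurable_tnth k)).
Qed.

Let expectation_cosh_scaled lam : 0 < lam ->
  ('E_P[fun w => cosh (lam * N w)%R] <= (expR ((lam * euclid_norm c) ^+ 2 / 2))%:E)%E.
Proof.
move=> lam0; pose scale (x : K.-tuple R) := map_tuple ( *%R lam) x.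
have m_scale : measurable_fun setT scale.
  apply/measurable_fun_tnthP => k; rewrite (_ : _ \o _ = (fun x => lam * tnth x k)).
    by apply: measurable_funM => //; exact: measurable_tnth.
  by apply/funext => x; rewrite /= tnth_map.
have normE (u : 'I_K -> R) : lam * euclid_norm u = euclid_norm (fun k => lam * u k).
  by rewrite euclid_normZ gtr0_norm.
have scale_tnth w i : tnth (scale (X i w)) = (fun k => lam * tnth (X i w) k).
  by apply/funext => k; rewrite tnth_map.
have := @expectation_cosh_norm_sum _ _ _ P n K
  (fun i => scale \o X i) (fun i => lam * c i).
rewrite euclid_normZ gtr0_norm//.
rewrite (_ : (fun w => cosh (euclid_norm _)) = (fun w => cosh (lam * N w))); last first.
  apply/funext => w; rewrite normE; congr (cosh (euclid_norm _)); apply/funext => k.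
  by rewrite mulr_sumr; apply: eq_bigr => i _; rewrite scale_tnth.
apply; first by move=> i; exact: measurableT_comp.
- exact: (mutually_independent_comp (f := fun=> scale)).
- move=> i k; under eq_Rintegral do rewrite /= scale_tnth.
  rewrite RintegralZl ?meanX ?mulr0//.
  apply: (@ae_bounded_integrable _ _ _ P _ (c i)).
    exact: (measurableT_comp (measurable_tnth k)).
  by apply: ae_imply (boundX i) => w; exact: le_trans (normr_le_euclid_norm _ _).
- move=> i; apply: ae_imply (boundX i) => w Xc /=.
  by rewrite scale_tnth -normE ler_pM2l.
Qed.

(* Markov's inequality for [cosh (lam * N)], with [lam = delta / euclid_norm c]. *)
Let tail_nondegenerate delta : 0 < delta -> euclid_norm c != 0 ->
  (P [set w | (delta * euclid_norm c < N w)%R] <= (2 * expR (- (delta ^+ 2) / 2))%:E)%E.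
Proof.
move=> d0 c0; have cp : 0 < euclid_norm c by rewrite lt_def c0 euclid_norm_ge0.
pose lam := delta / euclid_norm c; have lam0 : 0 < lam by rewrite divr_gt0.
have m_lamN : measurable_fun setT (fun w => lam * N w) by exact: measurable_funM.
have d2 : 0 < delta ^+ 2 by rewrite exprn_gt0.
pose lamN : {RV P >-> R} :=
  HB.pack (fun w => lam * N w) (isMeasurableFun.Build _ _ _ _ _ m_lamN).
have := markov lamN d2 measurable_cosh (fun r _ => cosh_ge0 r) (@ler_cosh R).
rewrite (_ : _ \o _ = (fun w => cosh (lam * N w))); last first.
  by apply/funext => w; rewrite /= ger0_norm// mulr_ge0 ?euclid_norm_ge0// ltW.
move=> /le_trans/(_ (expectation_cosh_scaled lam0)); rewrite divfK// => markovN.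
set A := [set w | _]; have mA : measurable A by exact: measurable_gt.
have PA : ((cosh (delta ^+ 2))%:E * P A <= (expR (delta ^+ 2 / 2))%:E)%E.
  apply: le_trans markovN; rewrite lee_pmul2l ?lte_fin ?cosh_gt0//.
  have eventE : [set w | ((delta ^+ 2)%:E <= `|(lamN w)%:E|)%E] =
      (fun w => lam * N w) @^-1` `[delta ^+ 2, +oo[%classic.
    apply/seteqP; split=> w /=; rewrite in_itv/= andbT lee_fin ger0_norm//;
    by rewrite mulr_ge0 ?euclid_norm_ge0// ltW.
  rewrite eventE; apply: le_measure; rewrite ?inE//.
    exact: measurable_preimage m_lamN (measurable_itv _).
  move=> w /= Nw; rewrite in_itv/= andbT -ler_pdivrMl// /lam invf_div expr2.
  by rewrite mulrACA mulVf ?gt_eqF// mulr1 mulrC ltW.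
move: PA; rewrite -(fineK (fin_num_measure P A mA)) -EFinM !lee_fin => PA.
have expR_split : expR (delta ^+ 2) * expR (- delta ^+ 2 / 2) = expR (delta ^+ 2 / 2).
  by rewrite -expRD; congr expR; lra.
rewrite -(ler_pM2l (expR_gt0 (delta ^+ 2))) mulrCA expR_split.
apply: le_trans (ler_wpM2l (ler0n _ 2) PA); rewrite mulrA ler_wpM2r ?fine_ge0//.
exact: expR_le_2cosh.
Qed.

Theorem pinelis delta : 0 < delta ->
  (P [set w | (delta * euclid_norm c < N w)%R] <= (2 * expR (- (delta ^+ 2) / 2))%:E)%E.
Proof.
move=> d0; have [c0|] := eqVneq (euclid_norm c) 0; last exact: tail_nondegenerate.
rewrite c0 mulr0 (_ : P _ = 0%E) ?lee_fin ?mulr_ge0 ?expR_ge0//.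
apply: measure_negligible; first exact: measurable_gt.
have : {ae P, forall w, N w <= 0}.
  apply: ae_imply (ae_forall boundX) => w X0.
  rewrite /euclid_norm big1 ?sqrtr0// => k _; rewrite big1 ?expr0n// => i _.
  apply/eqP; rewrite -normr_le0 (le_trans (normr_le_euclid_norm _ k))//.
  by rewrite (le_trans (X0 i))// (le_trans (ler_norm _))// -c0 normr_le_euclid_norm.
by apply: negligibleS => w /=; rewrite ltNge => /negP.
Qed.

End pinelis.

(** * The space L2 *)

Section L2.
Context {R : realType} (mu : {measure set (measurableTypeR R) -> \bar R}).
Implicit Types f g h : R -> R.
Local Notation L2 := (memL2 mu).
Local Notation "<| f , g |>" := (innerH mu f g).
Local Notation normH := (normH mu).

Lemma memL2P f : L2 f <-> f \in @Lfun _ (measurableTypeR R) R mu 2%:E.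
Proof.
split=> [[mf f2]|Lf].
  rewrite inE; apply/andP; split; rewrite inE//= /finite_norm unlock /=.
  apply: poweR_lty; under eq_integral do rewrite powR_mulrn// real_normK ?num_real//.
  exact: f2.
have /integrableP[_ f2] := Lfun2_integrable_sqr Lf.
split; first by move: Lf; rewrite inE => /andP[]; rewrite inE.
by move: f2; under eq_integral do rewrite /= ger0_norm ?sqr_ge0//.
Qed.

Lemma memL2D f g : L2 f -> L2 g -> L2 (f + g).
Proof.
by move=> /memL2P Lf /memL2P Lg; apply/memL2P; apply: rpredD => //; exact: lee1n.
Qed.

Lemma memL2B f g : L2 f -> L2 g -> L2 (f - g).
Proof.
by move=> /memL2P Lf /memL2P Lg; apply/memL2P; apply: rpredB => //; exact: lee1n.
Qed.

Lemma memL2Z (k : R) f : L2 f -> L2 (k *: f).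
Proof. by move=> /memL2P Lf; apply/memL2P; apply: rpredZ => //; exact: lee1n. Qed.

Lemma memL2_sum (I : Type) (s : seq I) (F : I -> R -> R) :
  (forall i, L2 (F i)) -> L2 (\sum_(i <- s) F i).
Proof.
by move=> LF; apply/memL2P; apply: rpred_sum => *; [exact: lee1n|exact/memL2P].
Qed.

Lemma memL2_lincomb (n : nat) (c : 'I_n -> R) (F : 'I_n -> R -> R) :
  (forall i, L2 (F i)) -> L2 (fun x => \sum_(i < n) c i * F i x).
Proof.
move=> LF; rewrite (_ : (fun x => _) = \sum_(i < n) c i *: F i).
  by apply: memL2_sum => i; exact: memL2Z.
by apply/funext => x; rewrite fct_sumE.
Qed.

Lemma memL2_integrableM f g : L2 f -> L2 g ->
  mu.-integrable setT (EFin \o (fun x => f x * g x)).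
Proof. by move=> /memL2P Lf /memL2P Lg; exact/Lfun1_integrable/Lfun2_mul_Lfun1. Qed.

Lemma innerHC f g : <|f, g|> = <|g, f|>.
Proof. by congr fine; apply: eq_integral => x _; rewrite mulrC. Qed.

Lemma innerHDl f g h : L2 f -> L2 g -> L2 h -> <|f + g, h|> = <|f, h|> + <|g, h|>.
Proof.
move=> Lf Lg Lh; rewrite -RintegralD//; try exact: memL2_integrableM.
by apply: eq_Rintegral => x _; rewrite mulrDl.
Qed.

Lemma innerHZl (k : R) f h : L2 f -> L2 h -> <|k *: f, h|> = k * <|f, h|>.
Proof.
move=> Lf Lh; rewrite -RintegralZl//; last exact: memL2_integrableM.
by apply: eq_Rintegral => x _; rewrite mulrA.
Qed.

Lemma innerHDr f g h : L2 f -> L2 g -> L2 h -> <|f, g + h|> = <|f, g|> + <|f, h|>.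
Proof. by move=> Lf Lg Lh; rewrite !(innerHC f) innerHDl. Qed.

Lemma innerHZr (k : R) f h : L2 f -> L2 h -> <|f, k *: h|> = k * <|f, h|>.
Proof. by move=> Lf Lh; rewrite !(innerHC f) innerHZl. Qed.

Lemma innerH_suml (I : Type) (s : seq I) (F : I -> R -> R) h :
  (forall i, L2 (F i)) -> L2 h -> <|\sum_(i <- s) F i, h|> = \sum_(i <- s) <|F i, h|>.
Proof.
move=> LF Lh; rewrite -Rintegral_sum; last by move=> i; exact: memL2_integrableM.
by apply: eq_Rintegral => x _; rewrite fct_sumE mulr_suml.
Qed.

Lemma ae_eq_innerHl f f' h : L2 f -> L2 f' -> L2 h ->
  {ae mu, forall x, f x = f' x} -> <|f, h|> = <|f', h|>.
Proof.
move=> Lf Lf' Lh ff'; congr fine; apply: ae_eq_integral => //.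
- exact: measurable_int (memL2_integrableM Lf Lh).
- exact: measurable_int (memL2_integrableM Lf' Lh).
- by apply: ae_imply ff' => x /= ->.
Qed.

Lemma innerH_ge0 f : 0 <= <|f, f|>.
Proof. by apply: Rintegral_ge0 => x _; rewrite -expr2 sqr_ge0. Qed.

Lemma normH_ge0 f : 0 <= normH f. Proof. exact: sqrtr_ge0. Qed.

Lemma sqr_normH f : normH f ^+ 2 = <|f, f|>.
Proof. by rewrite sqr_sqrtr// innerH_ge0. Qed.

Lemma integral_sqr f : L2 f -> (\int[mu]_x (f x ^+ 2)%:E)%E = (normH f ^+ 2)%:E.
Proof.
move=> Lf; rewrite sqr_normH fineK; last first.
  by apply: integrable_fin_num => //; exact: memL2_integrableM.
by apply: eq_integral => x _; rewrite expr2.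
Qed.

Lemma ae_eq_normH f g : L2 f -> L2 g -> {ae mu, forall x, f x = g x} ->
  normH f = normH g.
Proof.
move=> Lf Lg fg; rewrite /Defs.normH; congr Num.sqrt.
by rewrite (ae_eq_innerHl Lf Lg Lf fg) innerHC (ae_eq_innerHl Lf Lg Lg fg).
Qed.

Lemma normHZ (k : R) f : L2 f -> normH (k *: f) = `|k| * normH f.
Proof.
move=> Lf; rewrite /Defs.normH innerHZl ?innerHZr//; last exact: memL2Z.
by rewrite mulrA -expr2 sqrtrM ?sqr_ge0// sqrtr_sqr.
Qed.

Lemma sqr_normHD f g : L2 f -> L2 g ->
  normH (f + g) ^+ 2 = normH f ^+ 2 + 2 * <|f, g|> + normH g ^+ 2.
Proof.
move=> Lf Lg; have LD := memL2D Lf Lg.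
by rewrite !sqr_normH innerHDl// !innerHDr// (innerHC g f); ring.
Qed.

Lemma innerH_cauchy_schwarz f g : L2 f -> L2 g -> `|<|f, g|>| <= normH f * normH g.
Proof.
move=> Lf Lg; rewrite -sqrtrM ?innerH_ge0// -sqrtr_sqr ler_wsqrtr//.
apply: discriminant_le => [|t]; first exact: innerH_ge0.
have := sqr_ge0 (normH (f + t *: g)).
rewrite sqr_normHD//; last exact: memL2Z.
by rewrite normHZ// exprMn real_normK ?num_real// !sqr_normH innerHZr// mulrA.
Qed.

Lemma ler_normHD f g : L2 f -> L2 g -> normH (f + g) <= normH f + normH g.
Proof.
move=> Lf Lg; rewrite -(@ler_pXn2r _ 2) ?nnegrE ?addr_ge0 ?normH_ge0//.
rewrite sqr_normHD// sqrrD; have := innerH_cauchy_schwarz Lf Lg.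
by have := ler_norm <|f, g|>; lra.
Qed.

Lemma ler_normH_sum (I : Type) (s : seq I) (F : I -> R -> R) :
  (forall i, L2 (F i)) -> normH (\sum_(i <- s) F i) <= \sum_(i <- s) normH (F i).
Proof.
move=> LF; elim: s => [|i s ih].
  rewrite !big_nil /Defs.normH /innerH (eq_integral (cst 0%E)) ?integral0 ?sqrtr0//.
  by move=> x _; rewrite mul0r.
rewrite !big_cons (le_trans (ler_normHD _ _))// ?lerD2l//; exact: memL2_sum.
Qed.

(* First-order optimality along the segment from [z] to [y]. *)
Lemma nearest_point_obtuse y z h : L2 y -> L2 z -> L2 h ->
  (forall l : R, 0 <= l <= 1 -> normH (z - h) <= normH (l *: y + (1 - l) *: z - h)) ->
  0 <= <|y - z, z - h|>.
Proof.
move=> Ly Lz Lh nearest; set u := y - z; set v := z - h.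
have [Lu Lv] : L2 u /\ L2 v by split; exact: memL2B.
rewrite leNgt; apply/negP => uv.
have first_order (l : R) : 0 < l -> l <= 1 -> - 2 * <|u, v|> <= l * normH u ^+ 2.
  move=> l0 l1; have := nearest l; rewrite (ltW l0) l1 => /(_ erefl).
  have -> : l *: y + (1 - l) *: z - h = l *: u + v.
    by rewrite scalerBr scalerBl scale1r (addrC z) !addrA.
  have Llu : L2 (l *: u) by exact: memL2Z.
  rewrite -(@ler_pXn2r _ 2) ?nnegrE ?normH_ge0// (sqr_normHD Llu Lv).
  rewrite normHZ// innerHZl// exprMn real_normK ?num_real// => near_sqr.
  by rewrite -(ler_pM2l l0); lra.
have u2 : 0 <= normH u ^+ 2 by rewrite sqr_ge0.
pose l := Num.min 1 (- <|u, v|> / (normH u ^+ 2 + 1)).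
have l0 : 0 < l by rewrite lt_min ltr01/= divr_gt0 ?oppr_gt0// ltr_wpDl.
have l1 : l <= 1 by rewrite ge_min lexx.
have l2 : l * (normH u ^+ 2 + 1) <= - <|u, v|>.
  by rewrite -ler_pdivlMr ?ltr_wpDl// ge_min lexx orbT.
by have := first_order l l0 l1; lra.
Qed.

Lemma projection_dist_le y z h : L2 y -> L2 z -> L2 h ->
  (forall l : R, 0 <= l <= 1 -> normH (z - h) <= normH (l *: y + (1 - l) *: z - h)) ->
  normH (y - z) <= normH (y - h).
Proof.
move=> Ly Lz Lh /(nearest_point_obtuse Ly Lz Lh) obtuse.
have -> : y - h = (y - z) + (z - h) by rewrite subrKA.
rewrite -(@ler_pXn2r _ 2) ?nnegrE ?normH_ge0//.
rewrite (sqr_normHD (memL2B Ly Lz) (memL2B Lz Lh)).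
by rewrite -addrA lerDl addr_ge0 ?sqr_ge0// mulr_ge0.
Qed.

Lemma nearest_in_convex_dist_le (M : Type) (Psi : M -> R -> R) h (a b : M) :
  (forall c, L2 (Psi c)) -> L2 h ->
  (forall c c' (l : R), 0 <= l <= 1 ->
     exists c'', {ae mu, forall x, Psi c'' x = l * Psi c x + (1 - l) * Psi c' x}) ->
  (forall c, normH (Psi b - h) <= normH (Psi c - h)) ->
  normH (Psi a - Psi b) <= normH (Psi a - h).
Proof.
move=> LPsi Lh convexPsi nearest; apply: projection_dist_le => // l l01.
have [c cE] := convexPsi a b l l01.
rewrite (@ae_eq_normH (l *: Psi a + (1 - l) *: Psi b - h) (Psi c - h))//.
- by apply: memL2B => //; apply: memL2D; exact: memL2Z.
- exact: memL2B.
- by apply: ae_imply cE => x cx; rewrite !fctE/= cx.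
Qed.

End L2.

(** * Kernel operators *)

Lemma finite_sigma_finite {d} {T : measurableType d} {R : realType}
    (mu : {measure set T -> \bar R}) : (mu setT < +oo)%E ->
  exists m : {sigma_finite_measure set T -> \bar R},
    (m : {measure set T -> \bar R}) = mu.
Proof.
move=> muT; exists (mfrestr measurableT muT); apply: eq_measure.
by apply/funext => A; rewrite -[LHS]/(mu (A `&` setT)) setIT.
Qed.

Section kernel_operator.
Context {R : realType} (mu : {sigma_finite_measure set (measurableTypeR R) -> \bar R}).
Implicit Types (beta : R * R -> R) (f : R -> R).

(* The Borel structures of [R] and of [measurableTypeR R], which carries [mu],
   are convertible but have different displays. *)
Local Notation RR := (measurableTypeR R * measurableTypeR R)%type.

Lemma measurable_kerop beta f : measurable_fun setT beta -> measurable_fun setT f ->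
  measurable_fun setT (kerop mu beta f).
Proof.
move=> mb mf; pose F (z : RR) : \bar R := (beta z * f z.2)%:E.
have mF : measurable_fun setT F.
  apply/measurable_EFinP; apply: measurable_funM => //.
  exact: (measurableT_comp (f := f)).
have -> : kerop mu beta f =
    fine \o (fun x => \int[mu]_y F^\+ (x, y) - \int[mu]_y F^\- (x, y))%E.
  apply/funext => x; rewrite /kerop /innerH/= integralE; congr (fine (_ - _)%E).
    by apply: eq_integral => y _; rewrite !funeposE.
  by apply: eq_integral => y _; rewrite !funenegE.
apply: (measurableT_comp (fine_measurable measurableT)).
apply: (emeasurable_funB (T := measurableTypeR R)).
- by apply: (measurable_fun_fubini_tonelli_F F^\+%E) => //; exact: measurable_funepos.
- by apply: (measurable_fun_fubini_tonelli_F F^\-%E) => //; exact: measurable_funeneg.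
Qed.

Let sqr_ker beta (z : RR) : \bar R := (beta z ^+ 2)%:E.

Let measurable_sqr_ker beta :
  measurable_fun setT beta -> measurable_fun setT (sqr_ker beta).
Proof. by move=> mb; apply/measurable_EFinP; exact: measurable_funX. Qed.

Let sqr_ker_ge0 beta z : (0 <= sqr_ker beta z)%E.
Proof. by rewrite lee_fin sqr_ge0. Qed.

Let sqr_row beta (x : measurableTypeR R) : \bar R := (\int[mu]_y sqr_ker beta (x, y))%E.

Let measurable_sqr_row beta :
  measurable_fun setT beta -> measurable_fun setT (sqr_row beta).
Proof.
move=> mb; apply: (measurable_fun_fubini_tonelli_F (sqr_ker beta)) => //.
exact: measurable_sqr_ker.
Qed.

Let sqr_row_ge0 beta x : (0 <= sqr_row beta x)%E. Proof. exact: integral_ge0. Qed.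

Let integral_sqr_row beta : memL2ker mu beta ->
  (\int[mu]_x sqr_row beta x)%E = (normker2 mu beta)%:E.
Proof.
move=> [mb b2]; rewrite fineK; last first.
  by rewrite ge0_fin_numE//; do 2 (apply: integral_ge0 => ? _); exact: sqr_ker_ge0.
exact: (fubini_tonelli (sqr_ker beta) (measurable_sqr_ker mb) (sqr_ker_ge0 beta)).
Qed.

Lemma memL2ker_ae beta : memL2ker mu beta ->
  {ae mu, forall x, memL2 mu (fun y => beta (x, y))}.
Proof.
move=> b2; have [mb _] := b2.
have : mu.-integrable setT (sqr_row beta).
  apply/integrableP; split; first exact: measurable_sqr_row.
  by under eq_integral do rewrite gee0_abs//; rewrite integral_sqr_row// ltry.
move=> /(integrable_ae measurableT); apply: ae_imply => x /(_ I) row_fin.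
split; first exact: (measurableT_comp mb).
by rewrite -ge0_fin_numE//; exact: sqr_row_ge0.
Qed.

Lemma normker2_ge0 beta : 0 <= normker2 mu beta.
Proof. by apply: fine_ge0; do 2 (apply: integral_ge0 => ? _); exact: sqr_ker_ge0. Qed.

Let integral_sqr_kerop beta f : memL2ker mu beta -> memL2 mu f ->
  (\int[mu]_x ((kerop mu beta f x) ^+ 2)%:E <=
   (normker2 mu beta * normH mu f ^+ 2)%:E)%E.
Proof.
move=> b2 Lf; have mb := b2.1; have mk := measurable_kerop mb Lf.1.
rewrite EFinM -(integral_sqr_row b2) -ge0_integralZr//; last 2 first.
- exact: measurable_sqr_row.
- by rewrite lee_fin sqr_ge0.
apply: ae_ge0_le_integral => //.
- by move=> x _; rewrite lee_fin sqr_ge0.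
- by apply/measurable_EFinP; exact: measurable_funX.
- by move=> x _; rewrite mule_ge0// ?sqr_row_ge0// lee_fin sqr_ge0.
- by apply: emeasurable_funM => //; exact: measurable_sqr_row.
apply: ae_imply (memL2ker_ae b2) => x Lb _.
rewrite -[sqr_row beta x]/(\int[mu]_y (beta (x, y) ^+ 2)%:E)%E (integral_sqr Lb).
rewrite -EFinM lee_fin -exprMn -[leLHS]real_normK ?num_real//.
by rewrite lerXn2r ?nnegrE ?mulr_ge0 ?normH_ge0// innerH_cauchy_schwarz.
Qed.

Lemma memL2_kerop beta f : memL2ker mu beta -> memL2 mu f -> memL2 mu (kerop mu beta f).
Proof.
move=> b2 Lf; split; first exact: measurable_kerop b2.1 Lf.1.
exact: le_lt_trans (integral_sqr_kerop b2 Lf) (ltry _).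
Qed.

Lemma normH_kerop_le beta f : memL2ker mu beta -> memL2 mu f ->
  normH mu (kerop mu beta f) <= Num.sqrt (normker2 mu beta) * normH mu f.
Proof.
move=> b2 Lf; rewrite -(@ler_pXn2r _ 2) ?nnegrE ?mulr_ge0 ?normH_ge0 ?sqrtr_ge0//.
rewrite exprMn (sqr_sqrtr (normker2_ge0 beta)) -lee_fin.
by rewrite -(integral_sqr (memL2_kerop b2 Lf)) integral_sqr_kerop.
Qed.

Lemma kerop_sum_ae beta (I : Type) (s : seq I) (c : I -> R) (F : I -> R -> R) :
  memL2ker mu beta -> (forall i, memL2 mu (F i)) ->
  {ae mu, forall x, kerop mu beta (\sum_(i <- s) c i *: F i) x =
    \sum_(i <- s) c i * kerop mu beta (F i) x}.
Proof.
move=> b2 LF; apply: ae_imply (memL2ker_ae b2) => x Lb.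
rewrite /kerop innerHC innerH_suml//; last by move=> i; exact: memL2Z.
by apply: eq_bigr => i _; rewrite innerHZl// innerHC.
Qed.

End kernel_operator.

(** * Orthonormal families *)

Section orthonormal.
Context {R : realType} (mu : {measure set (measurableTypeR R) -> \bar R}).
Local Notation L2 := (memL2 mu).
Local Notation "<| f , g |>" := (innerH mu f g).
Local Notation normH := (normH mu).

Definition orthonormalH (K : nat) (h : 'I_K -> R -> R) : Prop :=
  (forall k, L2 (h k)) /\ (forall k l, <|h k, h l|> = (k == l)%:R).

Definition projH (K : nat) (h : 'I_K -> R -> R) (f : R -> R) : R -> R :=
  \sum_(k < K) <|f, h k|> *: h k.

Section finite_family.
Variables (K : nat) (h : 'I_K -> R -> R).
Hypothesis oh : orthonormalH h.

Lemma memL2_projH f : L2 (projH h f).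
Proof. by apply: memL2_sum => k; apply: memL2Z; case: oh. Qed.

Lemma innerH_projH f g : L2 g ->
  <|projH h f, g|> = \sum_(k < K) <|f, h k|> * <|g, h k|>.
Proof.
move=> Lg; have [Lh _] := oh.
rewrite innerH_suml//; last by move=> k; exact: memL2Z.
by apply: eq_bigr => k _; rewrite innerHZl// (innerHC _ (h k)).
Qed.

Lemma innerH_projH_basis f k : <|projH h f, h k|> = <|f, h k|>.
Proof.
have [Lh hh] := oh.
rewrite innerH_projH// (bigD1 k)//= hh eqxx mulr1 big1 ?addr0// => l lk.
by rewrite hh eq_sym (negbTE lk) mulr0.
Qed.

Lemma normH_projH f : normH (projH h f) = euclid_norm (fun k => <|f, h k|>).
Proof.
congr Num.sqrt; rewrite innerH_projH; last exact: memL2_projH.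
by apply: eq_bigr => k _; rewrite innerH_projH_basis expr2.
Qed.

Lemma bessel f : L2 f -> normH (projH h f) <= normH f.
Proof.
move=> Lf; have LP := memL2_projH f.
have [->|P0] := eqVneq (normH (projH h f)) 0; first exact: normH_ge0.
rewrite -(@ler_pM2l _ (normH (projH h f))) ?lt_def ?P0 ?normH_ge0// -expr2 normH_projH.
rewrite sqr_euclid_norm -normH_projH.
apply: le_trans (innerH_cauchy_schwarz LP Lf); apply: le_trans (ler_norm _).
by rewrite innerH_projH//; under eq_bigr do rewrite expr2.
Qed.

End finite_family.

(* Almost everywhere convergence and Fatou's lemma give [liminf |P_m f| >= |f|];
   Bessel's inequality is the converse, so no density argument is needed. *)
Lemma cvg_normH_projH (K : nat -> nat) (h : forall m, 'I_(K m) -> R -> R) f :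
  (forall m, orthonormalH (h m)) -> L2 f ->
  {ae mu, forall x, projH (h m) f x @[m --> \oo] --> f x} ->
  normH (projH (h m) f) @[m --> \oo] --> normH f.
Proof.
move=> oh Lf hf; pose u m : \bar R := (normH (projH (h m) f) ^+ 2)%:E.
have LP m := memL2_projH (oh m) f.
have u_le m : (u m <= (normH f ^+ 2)%:E)%E.
  by rewrite lee_fin lerXn2r ?nnegrE ?normH_ge0// (bessel (oh m)).
have einf_ge : ((normH f ^+ 2)%:E <= limn_einf u)%E.
  rewrite -(integral_sqr Lf) (_ : u = fun m => \int[mu]_x (projH (h m) f x ^+ 2)%:E)%E.
    apply: ae_fatou => [m|m x| |].
    - by apply/measurable_EFinP; apply: measurable_funX; exact: (LP m).1.
    - by rewrite lee_fin sqr_ge0.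
    - by apply/measurable_EFinP; apply: measurable_funX; exact: Lf.1.
    - apply: ae_imply hf => x hfx; apply: cvg_EFin; first exact: nearW.
      exact: cvgM.
  by apply/funext => m; rewrite integral_sqr.
have : u m @[m --> \oo] --> (normH f ^+ 2)%:E.
  rewrite -[X in _ --> X]oppeK (_ : u = -%E \o (-%E \o u)).
    apply: cvgeN; apply: limn_esup_le_cvg => [|m]; last by rewrite leeN2.
    by rewrite limn_esupN leeN2.
  by apply/funext => m; exact/esym/oppeK.
move=> /fine_cvg.
rewrite (_ : fine \o u = fun m => normH (projH (h m) f) ^+ 2)// => u_cvg.
have normHE g : normH g = Num.sqrt (normH g ^+ 2).
  by rewrite sqrtr_sqr ger0_norm ?normH_ge0.
rewrite normHE; under eq_fun do rewrite normHE.
by apply: continuous_cvg u_cvg; exact: sqrt_continuous.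
Qed.

End orthonormal.

(** * Approximation by normalized indicators *)

Section normalized_indicators.
Context {R : realType} (mu : {measure set (measurableTypeR R) -> \bar R}).

Lemma memL2_indic (A : set R) : measurable A -> (mu A < +oo)%E -> memL2 mu \1_A.
Proof.
move=> mA Afin; split; first exact: measurable_indic.
rewrite (_ : integral _ _ _ = \int[mu]_x (\1_A x)%:E)%E.
  by rewrite integral_indic ?setIT.
by apply: eq_integral => x _; rewrite indicE; case: (x \in A); rewrite ?expr1n ?expr0n.
Qed.

Lemma innerH_indic (f : R -> R) (A : set R) : innerH mu f \1_A = \int[mu]_(x in A) f x.
Proof.
rewrite Rintegral_mkcond; apply: eq_Rintegral => x _.
by rewrite patchE indicE; case: (x \in A); rewrite ?mulr1 ?mulr0.
Qed.

Variables (K : nat) (I : 'I_K -> set R) (s : 'I_K -> R).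
Hypothesis measurable_I : forall k, measurable (I k).
Hypothesis disjoint_I : forall k l x, I k x -> I l x -> k = l.
Hypothesis mu_I : forall k, mu (I k) = (s k)%:E.
Hypothesis s_gt0 : forall k, 0 < s k.

Definition normalized_indic (k : 'I_K) : R -> R := (Num.sqrt (s k))^-1 *: \1_(I k).

Let memL2_indicI k : memL2 mu \1_(I k).
Proof. by apply: memL2_indic => //; rewrite mu_I ltry. Qed.

Let invr_sqrtM k : (Num.sqrt (s k))^-1 * (Num.sqrt (s k))^-1 = (s k)^-1.
Proof. by rewrite -invfM -expr2 sqr_sqrtr// ltW. Qed.

Lemma orthonormal_normalized_indic : orthonormalH mu normalized_indic.
Proof.
split=> [k|k l]; first exact: memL2Z.
rewrite innerHZl ?innerHZr//; last exact: memL2Z.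
rewrite innerH_indic /Rintegral (_ : integral _ _ _ = mu (I k `&` I l)); last first.
  by apply: integral_indic; exact: measurable_I.
have [<-|kl] := eqVneq k l.
  by rewrite setIid mu_I/= mulrA invr_sqrtM mulVf// gt_eqF.
rewrite (_ : _ `&` _ = set0) ?measure0/= ?mulr0//.
by apply/seteqP; split=> // x [Ik Il]; move: kl; rewrite (disjoint_I Ik Il) eqxx.
Qed.

Lemma projH_normalized_indic (f : R -> R) k x : memL2 mu f -> I k x ->
  projH mu normalized_indic f x = (s k)^-1 * \int[mu]_(x in I k) f x.
Proof.
move=> Lf Ikx; rewrite /projH fct_sumE (bigD1 k)//= [X in _ + X]big1 ?addr0.
  rewrite innerHZr// innerH_indic -invr_sqrtM.
  rewrite /normalized_indic !scalrfctE/= indicE mem_set//.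
  by rewrite -[LHS]/(_ * (_ * _)) mulr1 mulrAC.
move=> l lk; rewrite /normalized_indic !scalrfctE/= indicE memNset ?scaler0// => Il.
by move: lk; rewrite (disjoint_I Ikx Il) eqxx.
Qed.

End normalized_indicators.

Section orthonormal_approximation.
Context {R : realType} (mu : {measure set (measurableTypeR R) -> \bar R}).

Definition orthonormal_approximation (K : nat -> nat)
    (h : forall m, 'I_(K m) -> R -> R) : Prop :=
  (forall m, orthonormalH mu (h m)) /\
  (forall f, memL2 mu f -> {ae mu, forall x, projH mu (h m) f x @[m --> \oo] --> f x}).

Lemma orthonormal_approximation_counting (d : nat) : (forall A, measurable A ->
    mu A = counting (A `&` [set (k.+1)%:R | k in [set k : nat | (k < d)%N]])) ->
  exists K (h : forall m, 'I_(K m) -> R -> R), orthonormal_approximation h.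
Proof.
set D := [set _ | k in _] => muE.
pose atom (k : 'I_d) : set R := [set k.+1%:R].
have m_atom k : measurable (atom k) by exact: measurable_set1.
have mu_atom k : mu (atom k) = 1%:E.
  rewrite muE; last exact: m_atom.
  rewrite setIidl; last by move=> _ ->; exists (k : nat) => /=.
  by rewrite /counting asboolT ?fset_set1 ?finmap.cardfs1//; exact: finite_set1.
have disj_atom (k l : 'I_d) x : atom k x -> atom l x -> k = l.
  by move=> -> /eqP; rewrite eqr_nat eqSS => /eqP; exact: val_inj.
have mD : measurable D.
  rewrite (_ : D = \bigcup_(k in [set k : nat | (k < d)%N]) [set k.+1%:R]).
    exact: bigcup_measurable.
  by apply/seteqP; split=> [_ [k kd <-]|_ [k kd ->]]; exists k.
exists (fun=> d), (fun=> normalized_indic atom (fun=> 1)); split=> [_|f Lf].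
  exact: orthonormal_normalized_indic.
exists (~` D); split; first exact: measurableC.
  by rewrite muE; [rewrite setICl /counting asboolT// fset_set0|exact: measurableC].
move=> x /= not_cvg Dx; apply: not_cvg; case: Dx => k kd <-.
rewrite (_ : (fun=> _) = (fun=> f k.+1%:R)); first exact: cvg_cst.
apply/funext => _; have atom_k : atom (Ordinal kd) k.+1%:R by [].
rewrite (projH_normalized_indic m_atom disj_atom mu_atom (fun=> ltr01) Lf atom_k).
rewrite invr1 mul1r (@eq_Rintegral _ _ _ mu _ (cst (f k.+1%:R))); last first.
  by move=> y; rewrite inE => ->.
by rewrite Rintegral_cst; [rewrite mu_atom mulr1|exact: m_atom].
Qed.

End orthonormal_approximation.

Section interval_grid.
Context {R : realType} (a b : R).
Hypothesis ab : a < b.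

Definition grid_step (m : nat) : R := (b - a) / m.+1%:R.

Definition grid_cell (m : nat) (z : int) : set R :=
  `[a + z%:~R * grid_step m, a + (z + 1)%:~R * grid_step m[%classic.

Definition grid_index (m : nat) (x : R) : int := Num.floor ((x - a) / grid_step m).

Lemma grid_step_gt0 m : 0 < grid_step m.
Proof. by rewrite divr_gt0// subr_gt0. Qed.

Lemma grid_cellP m z x : grid_cell m z x <-> grid_index m x = z.
Proof.
have step_gt0 := grid_step_gt0 m.
rewrite /grid_cell /grid_index /= in_itv/= -lerBrDl -ltrBlDl.
rewrite -ler_pdivlMr// -ltr_pdivrMr//.
by split=> [|<-]; [exact: floor_def|exact: floor_itv].
Qed.

Lemma grid_cell_inj m (k l : 'I_m.+1) x : grid_cell m k x -> grid_cell m l x -> k = l.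
Proof. by move=> /grid_cellP kx /grid_cellP; rewrite kx => -[] /val_inj. Qed.

Lemma measurable_grid_cell m z : measurable (grid_cell m z).
Proof. exact: measurable_itv. Qed.

Lemma lebesgue_measure_grid_cell m z :
  lebesgue_measure (grid_cell m z) = (grid_step m)%:E.
Proof.
rewrite lebesgue_measure_itv/= lte_fin ltrD2l ltr_pM2r ?grid_step_gt0//.
by rewrite ltr_int ltrDl ltr01 -EFinB; congr EFin; rewrite intrD; ring.
Qed.

Lemma grid_cell_sub m (k : 'I_m.+1) : grid_cell m k `<=` `[a, b].
Proof.
move=> x; rewrite /grid_cell /= !in_itv/= => /andP[ax xb]; apply/andP; split.
  by rewrite (le_trans _ ax)// lerDl mulr_ge0// ltW// grid_step_gt0.
rewrite (le_trans (ltW xb))// -lerBrDl /grid_step mulrCA; apply: ler_piMr.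
  by rewrite subr_ge0 ltW.
rewrite ler_pdivrMr ?ltr0n// mul1r (_ : (_ + 1)%:~R = k.+1%:R :> R) ?ler_nat ?ltn_ord//.
by rewrite intrD -natr1.
Qed.

Lemma grid_index_ord m x : x \in `[a, b[ -> exists k : 'I_m.+1, grid_index m x = k.
Proof.
rewrite in_itv/= => /andP[ax xb]; have step_gt0 := grid_step_gt0 m.
have index_ge0 : 0 <= grid_index m x by rewrite floor_ge0 divr_ge0 ?subr_ge0// ltW.
have index_lt : grid_index m x < m.+1%:Z.
  rewrite floor_lt_int ltr_pdivrMr// -pmulrn /grid_step mulrC divfK ?pnatr_eq0//.
  by rewrite ltrD2r.
case: (grid_index m x) index_ge0 index_lt => // k _ km.
by exists (Ordinal (km : (k < m.+1)%N)).
Qed.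

Lemma nicely_shrinking_grid x :
  nicely_shrinking x (fun m => grid_cell m (grid_index m x)).
Proof.
split=> [m|]; first exact: measurable_grid_cell.
exists (2, fun m => PosNum (grid_step_gt0 m)); split => //=.
- rewrite -(mulr0 (b - a)); apply: cvgMl_tmp; exact: cvg_harmonic.
- move=> m y; have : grid_cell m (grid_index m x) x by apply/grid_cellP.
  rewrite /grid_cell/= !in_itv/= => /andP[x1 x2] /andP[y1 y2].
  rewrite /ball/= ltr_norml; move: x1 x2 y1 y2; rewrite !intrD !mulrDl mul1r.
  by move: (_ * grid_step m) => u *; apply/andP; split; lra.
- move=> m; rewrite lebesgue_measure_ball ?(ltW (grid_step_gt0 m))//.
  by rewrite lebesgue_measure_grid_cell -EFinM mulr_natl.
Qed.

End interval_grid.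

Section lebesgue_on_itv.
Context {R : realType} (mu : {measure set (measurableTypeR R) -> \bar R}) (a b : R).
Hypothesis ab : a < b.
Hypothesis muE : forall A, measurable A -> mu A = lebesgue_measure (A `&` `[a, b]).

Let integral_lebesgue (D : set R) (g : R -> \bar R) : D `<=` `[a, b] ->
  (\int[mu]_(x in D) g x = \int[lebesgue_measure]_(x in D) g x)%E.
Proof.
move=> Dab; apply: eq_measure_integral => A mA AD; rewrite muE// setIidl//.
exact: subset_trans Dab.
Qed.

Lemma lebesgue_on_itv_fin : (mu setT < +oo)%E.
Proof.
rewrite muE// setTI lebesgue_measure_itv/=.
by case: ifP => // _; rewrite -EFinB ltry.
Qed.

Let ae_lebesgue (A : R -> Prop) :
  {ae @lebesgue_measure R, forall x, A x} -> {ae mu, forall x, A x}.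
Proof.
move=> [N [mN N0 NA]]; exists N; split=> //.
rewrite muE//; apply/eqP; rewrite eq_le measure_ge0 andbT -N0.
by apply: le_measure; rewrite ?inE//; exact: measurableI.
Qed.

Let ae_in_itv : {ae mu, forall x, x \in `[a, b[}.
Proof.
have mab : measurable (~` `[a, b[%classic : set R).
  by apply: measurableC; exact: measurable_itv.
exists (~` `[a, b[%classic); split=> [//||x //].
rewrite muE// (_ : _ `&` _ = [set b]) ?lebesgue_measure_set1//.
apply/seteqP; split=> x /=; rewrite !in_itv/=; last first.
  by move=> ->; rewrite ltxx andbF lexx (ltW ab).
move=> [/negP + /andP[ax xb]]; rewrite ax/= -leNgt => bx.
by apply/eqP; rewrite eq_le xb.
Qed.

Let integrable_itv (f : R -> R) : memL2 mu f ->
  lebesgue_measure.-integrable `[a, b]%classic (EFin \o f).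
Proof.
move=> Lf; have mab : @measurable _ (measurableTypeR R) `[a, b]%classic.
  exact: measurable_itv.
apply/integrableP; split.
  by apply/measurable_EFinP; apply: measurable_funTS; exact: Lf.1.
rewrite -integral_lebesgue//.
have /integrableP[_] := integrableS measurableT mab (@subsetT _ _)
  (memL2_integrableM Lf (memL2_indic measurableT lebesgue_on_itv_fin)).
by under eq_integral do rewrite /= indicT mulr1.
Qed.

Let cell_basis (m : nat) : 'I_m.+1 -> R -> R :=
  normalized_indic (fun k : 'I_m.+1 => grid_cell a b m k) (fun=> grid_step a b m).

Let mu_grid_cell m (k : 'I_m.+1) : mu (grid_cell a b m k) = (grid_step a b m)%:E.
Proof.
rewrite muE; last exact: measurable_grid_cell.
by rewrite setIidl ?lebesgue_measure_grid_cell//; exact: grid_cell_sub.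
Qed.

Let projH_cell_basis (f : R -> R) m x : memL2 mu f -> x \in `[a, b[ ->
  projH mu (@cell_basis m) f x =
  fine ((lebesgue_measure (grid_cell a b m (grid_index a b m x)))^-1 *
    \int[lebesgue_measure]_(y in grid_cell a b m (grid_index a b m x))
      ((f \_ `[a, b]) y)%:E)%E.
Proof.
move=> Lf xab; have [k kx] := grid_index_ord ab m xab; rewrite kx.
have sub_ab := grid_cell_sub ab (k := k).
have cell_x : grid_cell a b m k x by exact/grid_cellP.
rewrite (projH_normalized_indic (fun l => measurable_grid_cell a b m l)
  (@grid_cell_inj _ _ _ ab m) (@mu_grid_cell m) (fun=> grid_step_gt0 ab m) Lf cell_x).
rewrite lebesgue_measure_grid_cell// inver gt_eqF ?grid_step_gt0//.
rewrite (_ : integral _ _ _ =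
  \int[lebesgue_measure]_(y in grid_cell a b m k) (f y)%:E)%E.
  rewrite fineM//; first by rewrite /Rintegral integral_lebesgue.
  apply: integrable_fin_num; first exact: measurable_grid_cell.
  by apply: integrableS (integrable_itv Lf) => //; exact: measurable_grid_cell.
by apply: eq_integral => y; rewrite inE => /sub_ab yab; rewrite patchE mem_set.
Qed.

Lemma orthonormal_approximation_lebesgue :
  exists K (h : forall m, 'I_(K m) -> R -> R), orthonormal_approximation mu h.
Proof.
exists succn, cell_basis; split=> [m|f Lf].
  apply: orthonormal_normalized_indic.
  - by move=> k; exact: measurable_grid_cell.
  - exact: grid_cell_inj.
  - exact: mu_grid_cell.
  - by move=> _; exact: grid_step_gt0.
have lf : locally_integrable setT (f \_ `[a, b]).
  by apply: integrable_locally_restrict (integrable_itv Lf); exact: measurable_itv.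
have ae_lebesgue_pt := ae_lebesgue (lebesgue_differentiation lf).
apply: ae_imply2 ae_in_itv ae_lebesgue_pt => x xab lebesgue_x.
have := nice_lebesgue_differentiation (nicely_shrinking_grid ab) lf lebesgue_x.
move=> /fine_cvg; rewrite patchE mem_set/=; last first.
  by move: xab; rewrite !in_itv/= => /andP[-> /ltW].
by apply: cvg_trans; apply: near_eq_cvg; apply: nearW => m /=; rewrite projH_cell_basis.
Qed.

End lebesgue_on_itv.

Lemma std_space_fin (R : realType) (mu : {measure set (measurableTypeR R) -> \bar R}) :
  std_space mu -> (mu setT < +oo)%E.
Proof.
case=> [[a [b [_ muE]]]|[d [_ muE]]]; first exact: lebesgue_on_itv_fin muE.
rewrite muE// setTI.
by rewrite /counting asboolT ?ltry//; apply: finite_image; exact: finite_II.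
Qed.

Lemma std_space_orthonormal_approximation (R : realType)
    (mu : {measure set (measurableTypeR R) -> \bar R}) :
  std_space mu ->
  exists K (h : forall m, 'I_(K m) -> R -> R), orthonormal_approximation mu h.
Proof.
case=> [[a [b [ab muE]]]|[d [_ muE]]].
  exact: orthonormal_approximation_lebesgue ab muE.
exact: orthonormal_approximation_counting muE.
Qed.

(** * Concentration in L2 *)

Section weighted_sum.
Context {R : realType} (mu : {measure set (measurableTypeR R) -> \bar R}).
Context {dO : measure_display} {Omega : measurableType dO} (P : probability Omega R).
Variables (n : nat) (X : 'I_n -> Omega -> R -> R) (c sigma : 'I_n -> R).
Hypothesis randX : forall i, H_random_element mu (X i).
Hypothesis indepX : H_independent mu P X.
Hypothesis meanX : forall i, H_mean_zero mu P (X i).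
Hypothesis boundX : forall i, {ae P, forall w, normH mu (X i w) <= sigma i}.

(* The measurable sets of [H] are, up to conversion, those of [Hmeasurable mu]. *)
Let H := g_sigma_algebraType
  [set A | exists h B, memL2 mu h /\ measurable (B : set R) /\
           A = [set f | B (innerH mu f h)]].

Let measurable_X i : measurable_fun setT (X i : Omega -> H).
Proof. by move=> _ B mB; rewrite setTI; exact: (randX i).2. Qed.

Let memL2_X i w : memL2 mu (X i w). Proof. exact: (randX i).1. Qed.

Local Notation S w := (\sum_(i < n) c i *: X i w).

Let memL2_S w : memL2 mu (S w).
Proof. by apply: memL2_sum => i; exact: memL2Z. Qed.

Let measurable_innerH h :
  memL2 mu h -> measurable_fun [set: H] (innerH mu ^~ h : H -> R).
Proof.
move=> Lh _ B mB; rewrite setTI; apply: sub_sigma_algebra.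
by exists h, B.
Qed.

Section projection.
Variables (K : nat) (h : 'I_K -> R -> R).
Hypothesis oh : orthonormalH mu h.

Let coords (i : 'I_n) (f : H) : K.-tuple R := [tuple c i * innerH mu f (h k) | k < K].

Let measurable_coords i : measurable_fun setT (coords i).
Proof.
apply/measurable_fun_tnthP => k.
rewrite (_ : _ \o _ = fun f => c i * innerH mu f (h k)).
  by apply: measurable_funM => //; apply: measurable_innerH; exact: oh.1.
by apply/funext => f; rewrite /= tnth_mktuple.
Qed.

Let normH_projH_S w :
  normH mu (projH mu h (S w)) =
  euclid_norm (fun k => \sum_(i < n) tnth (coords i (X i w)) k).
Proof.
rewrite normH_projH//; congr euclid_norm; apply/funext => k.
rewrite innerH_suml; [|by move=> i; exact: memL2Z|exact: oh.1].
by apply: eq_bigr => i _; rewrite tnth_mktuple innerHZl//; exact: oh.1.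
Qed.

Let coords_bound i :
  {ae P, forall w, euclid_norm (tnth (coords i (X i w))) <= `|c i| * sigma i}.
Proof.
apply: ae_imply (boundX i) => w X_le.
rewrite (_ : tnth _ = fun k => c i * innerH mu (X i w) (h k)); last first.
  by apply/funext => k; rewrite tnth_mktuple.
by rewrite euclid_normZ ler_wpM2l// -normH_projH// (le_trans (bessel oh _)).
Qed.

Let coords_mean i k : \int[P]_w tnth (coords i (X i w)) k = 0.
Proof.
under eq_Rintegral do rewrite tnth_mktuple.
rewrite RintegralZl//; first by rewrite /Rintegral meanX ?mulr0//; exact: oh.1.
apply: (@ae_bounded_integrable _ _ _ P _ (sigma i)).
  exact: (measurableT_comp (measurable_innerH (oh.1 k))).
apply: ae_imply (boundX i) => w; apply: le_trans.
apply: le_trans (bessel oh (memL2_X i w)); rewrite normH_projH//.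
exact: (normr_le_euclid_norm (fun k => innerH mu (X i w) (h k))).
Qed.

Lemma measurable_normH_projH :
  measurable_fun setT (fun w => normH mu (projH mu h (S w))).
Proof.
under eq_fun do rewrite normH_projH_S.
apply: (measurable_euclid_norm
  (f := fun k w => \sum_(i < n) tnth (coords i (X i w)) k)) => k.
apply: measurable_sum => i; apply: (measurableT_comp (measurable_tnth k)).
exact: (measurableT_comp (measurable_coords i) (measurable_X i)).
Qed.

Lemma projH_tail delta : 0 < delta ->
  (P [set w | (delta * euclid_norm (fun i => c i * sigma i) <
     normH mu (projH mu h (S w)))%R] <= (2 * expR (- (delta ^+ 2) / 2))%:E)%E.
Proof.
move=> d0.
have indep_coords : mutually_independent P (fun i => coords i \o X i).
  exact: (mutually_independent_comp (T1 := H) indepX).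
have := pinelis (fun i => measurableT_comp (measurable_coords i) (measurable_X i))
  indep_coords coords_mean coords_bound d0.
have -> : euclid_norm (fun i => `|c i| * sigma i) =
    euclid_norm (fun i => c i * sigma i).
  congr Num.sqrt; apply: eq_bigr => i _; rewrite !exprMn real_normK ?num_real//.
by under eq_set do rewrite -normH_projH_S.
Qed.

End projection.

Section approximation.
Variables (K : nat -> nat) (h : forall m, 'I_(K m) -> R -> R).
Hypothesis approx : orthonormal_approximation mu h.

Let normH_projH_cvg w :
  normH mu (projH mu (@h m) (S w)) @[m --> \oo] --> normH mu (S w).
Proof.
by apply: cvg_normH_projH (memL2_S w) (approx.2 _ (memL2_S w)); exact: approx.1.
Qed.

Lemma measurable_normH_weighted_sum : measurable_fun setT (fun w => normH mu (S w)).
Proof.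
apply: (measurable_fun_cvg (fun m => measurable_normH_projH (approx.1 m))) => w _.
exact: normH_projH_cvg.
Qed.

Lemma normH_weighted_sum_tail delta : 0 < delta ->
  (P [set w | (delta * euclid_norm (fun i => c i * sigma i) < normH mu (S w))%R] <=
   (2 * expR (- (delta ^+ 2) / 2))%:E)%E.
Proof.
move=> d0.
apply: (measure_gt_lim_le (f_ := fun m w => normH mu (projH mu (@h m) (S w)))).
- by move=> m; apply: measurable_normH_projH; exact: approx.1.
- exact: normH_projH_cvg.
- by move=> m; apply: projH_tail => //; exact: approx.1.
Qed.

End approximation.

End weighted_sum.

(** * The weighting estimator *)

Section regression.
Context {R : realType} (mu : {sigma_finite_measure set (measurableTypeR R) -> \bar R}).
Variables (T0 p : nat) (beta : 'I_T0 -> R * R -> R) (eta : 'I_p -> R -> R).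
Hypothesis L2beta : forall t, memL2ker mu (beta t).
Hypothesis L2eta : forall l, memL2 mu (eta l).

Lemma normH_sum_kerop_le (f : 'I_T0 -> R -> R) : (forall t, memL2 mu (f t)) ->
  normH mu (\sum_(t < T0) kerop mu (beta t) (f t)) <=
  Num.sqrt (\sum_(t < T0) normker2 mu (beta t)) * euclid_norm (fun t => normH mu (f t)).
Proof.
move=> Lf.
rewrite (le_trans (ler_normH_sum _ (fun t => memL2_kerop (L2beta t) (Lf t))))//.
rewrite (le_trans (ler_sum _ (fun t _ => normH_kerop_le (L2beta t) (Lf t))))//.
rewrite (le_trans (ler_norm _))// (le_trans (euclid_cauchy_schwarz _ _))//.
rewrite ler_wpM2r ?euclid_norm_ge0// ler_wsqrtr// ler_sum// => t _.
by rewrite sqr_sqrtr// normker2_ge0.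
Qed.

Lemma normH_sum_scale_le (z : 'I_p -> R) :
  normH mu (\sum_(l < p) z l *: eta l) <=
  euclid_norm (fun l => normH mu (eta l)) * euclid_norm z.
Proof.
rewrite (le_trans (ler_normH_sum _ (fun l => memL2Z (z l) (L2eta l))))//.
under eq_bigr do rewrite normHZ// mulrC.
rewrite (le_trans (ler_norm _))// (le_trans (euclid_cauchy_schwarz _ _))//.
rewrite ler_wpM2l ?euclid_norm_ge0// ler_wsqrtr// ler_sum// => l _.
by rewrite real_normK ?num_real.
Qed.

Variables (n : nat) (c : 'I_n -> R) (f : 'I_n -> 'I_T0 -> R -> R).
Variables (z : 'I_n -> 'I_p -> R) (e Y : 'I_n -> R -> R).
Hypothesis L2f : forall i t, memL2 mu (f i t).
Hypothesis L2e : forall i, memL2 mu (e i).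
Hypothesis L2Y : forall i, memL2 mu (Y i).
Hypothesis model : forall i, {ae mu, forall x, Y i x =
  \sum_(t < T0) kerop mu (beta t) (f i t) x + \sum_(l < p) eta l x * z i l + e i x}.

Local Notation F t := (\sum_(i < n) c i *: f i t).
Local Notation Z l := (\sum_(i < n) c i * z i l).
Local Notation E := (\sum_(i < n) c i *: e i).

Let memL2_F t : memL2 mu (F t).
Proof. by apply: memL2_sum => i; exact: memL2Z. Qed.

Let model_weighted : {ae mu, forall x, (\sum_(i < n) c i *: Y i) x =
  (\sum_(t < T0) kerop mu (beta t) (F t) + \sum_(l < p) Z l *: eta l + E) x}.
Proof.
have kerop_F : {ae mu, forall x, forall t, kerop mu (beta t) (F t) x =
    \sum_(i < n) c i * kerop mu (beta t) (f i t) x}.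
  by apply: ae_forall => t; exact: kerop_sum_ae.
apply: ae_imply2 kerop_F (ae_forall model) => x kx Yx.
rewrite !fctE !fct_sumE (eq_bigr _ (fun t _ => kx t)) exchange_big/=.
rewrite [X in _ + X + _](_ : _ = \sum_(i < n) \sum_(l < p) c i * (eta l x * z i l)).
  rewrite -!big_split/=; apply: eq_bigr => i _.
  by rewrite -[LHS]/(c i * Y i x) Yx !mulrDr !mulr_sumr.
rewrite exchange_big/=; apply: eq_bigr => l _.
rewrite -[LHS]/(Z l * eta l x) mulr_suml; apply: eq_bigr => i _; ring.
Qed.

Lemma normH_weighted_regression_le : normH mu (\sum_(i < n) c i *: Y i) <=
  Num.sqrt (\sum_(t < T0) normker2 mu (beta t)) *
    euclid_norm (fun t => normH mu (F t)) +
  euclid_norm (fun l => normH mu (eta l)) * euclid_norm (fun l => Z l) + normH mu E.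
Proof.
have LE : memL2 mu E by apply: memL2_sum => i; exact: memL2Z.
have LK : memL2 mu (\sum_(t < T0) kerop mu (beta t) (F t)).
  by apply: memL2_sum => t; exact: memL2_kerop.
have LZ : memL2 mu (\sum_(l < p) Z l *: eta l) by apply: memL2_sum => l; exact: memL2Z.
rewrite (ae_eq_normH _ _ model_weighted).
- rewrite (le_trans (ler_normHD (memL2D LK LZ) LE))// lerD2r.
  rewrite (le_trans (ler_normHD LK LZ))// lerD ?normH_sum_scale_le//.
  exact: normH_sum_kerop_le.
- by apply: memL2_sum => i; exact: memL2Z.
- exact: memL2D (memL2D LK LZ) LE.
Qed.

End regression.

(* The weights of [F_1 - sum_j gamma_j F_j] as a combination of all the units. *)
Definition contrast_weight {R : realType} {n : nat} (gamma : 'I_n -> R)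
    (i : 'I_n.+1) : R :=
  oapp (fun j => - gamma j) 1 (unlift ord0 i).

Section contrast_weight.
Context {R : realType} {n : nat} (gamma : 'I_n -> R).

Lemma sum_contrast_weight (F : 'I_n.+1 -> R) :
  \sum_(i < n.+1) contrast_weight gamma i * F i =
  F ord0 - \sum_(j < n) gamma j * F (lift ord0 j).
Proof.
rewrite /contrast_weight big_ord_recl unlift_none/= mul1r -sumrN; congr (_ + _).
by apply: eq_bigr => j _; rewrite liftK/= mulNr.
Qed.

Lemma scale_contrast_weight (F : 'I_n.+1 -> R -> R) :
  \sum_(i < n.+1) contrast_weight gamma i *: F i =
  (fun x => F ord0 x - \sum_(j < n) gamma j * F (lift ord0 j) x).
Proof. by apply/funext => x; rewrite fct_sumE -(sum_contrast_weight (F ^~ x)). Qed.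

Lemma euclid_norm_contrast_weight :
  euclid_norm (contrast_weight gamma) <= 1 + euclid_norm gamma.
Proof.
have g0 := euclid_norm_ge0 gamma.
rewrite -(@ler_pXn2r _ 2) ?nnegrE ?euclid_norm_ge0 ?addr_ge0//.
rewrite sqr_euclid_norm /contrast_weight big_ord_recl unlift_none/= expr1n sqrrD expr1n.
rewrite (eq_bigr (fun j => gamma j ^+ 2)) => [|j _]; last by rewrite liftK/= sqrrN.
by rewrite -sqr_euclid_norm; lra.
Qed.

Lemma euclid_norm_contrast_weightMr (s : R) : 0 <= s ->
  euclid_norm (fun i => contrast_weight gamma i * s) <= s * (1 + euclid_norm gamma).
Proof.
move=> s0; under eq_fun do rewrite mulrC.
by rewrite euclid_normZ ger0_norm// ler_wpM2l// euclid_norm_contrast_weight.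
Qed.

End contrast_weight.

Section contrast_regression.
Context {R : realType} (mu : {sigma_finite_measure set (measurableTypeR R) -> \bar R}).
Variables (T0 p n : nat) (beta : 'I_T0 -> R * R -> R) (eta : 'I_p -> R -> R).
Variables (gamma : 'I_n -> R) (f : 'I_n.+1 -> 'I_T0 -> R -> R).
Variables (z : 'I_n.+1 -> 'I_p -> R) (e Y : 'I_n.+1 -> R -> R).

Lemma normH_contrast_regression_le :
  (forall t, memL2ker mu (beta t)) -> (forall l, memL2 mu (eta l)) ->
  (forall i t, memL2 mu (f i t)) ->
  (forall i, memL2 mu (e i)) -> (forall i, memL2 mu (Y i)) ->
  (forall i, {ae mu, forall x, Y i x =
     \sum_(t < T0) kerop mu (beta t) (f i t) x + \sum_(l < p) eta l x * z i l + e i x}) ->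
  normH mu (fun x => Y ord0 x - \sum_(j < n) gamma j * Y (lift ord0 j) x) <=
  Num.sqrt (\sum_(t < T0) normker2 mu (beta t)) *
    euclid_norm (fun t => normH mu
      (fun x => f ord0 t x - \sum_(j < n) gamma j * f (lift ord0 j) t x)) +
  euclid_norm (fun l => normH mu (eta l)) *
    euclid_norm (fun l => z ord0 l - \sum_(j < n) gamma j * z (lift ord0 j) l) +
  normH mu (\sum_(i < n.+1) contrast_weight gamma i *: e i).
Proof.
move=> Lbeta Leta Lf Le LY model.
have := normH_weighted_regression_le Lbeta Leta (contrast_weight gamma) Lf Le LY model.
rewrite scale_contrast_weight (funext (fun l => sum_contrast_weight gamma (z ^~ l))).
by rewrite (funext (fun t => congr1 (normH mu) (scale_contrast_weight gamma (f ^~ t)))).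
Qed.

End contrast_regression.

(* Units: 'I_Nc.+1, unit ord0 is the treated unit (unit 1 of the paper),
   controls are lift ord0 j, j : 'I_Nc (units 2..N of the paper; N = Nc+1).
   Pre-treatment periods: 'I_T0 (t = 1..T0); post period T = T0+1. *)
Theorem theoremB1 (R : realType)
  (mu : {measure set (measurableTypeR R) -> \bar R})
  (M : Type) (d : M -> M -> R) (Psi : M -> R -> R)
  (dO : measure_display) (Omega : measurableType dO) (P : probability Omega R)
  (Nc T0 p : nat)
  (Ypre : 'I_Nc.+1 -> 'I_T0 -> R -> R)          (* Y_{it} = Y^N_{it}, t <= T0 *)
  (nuN : 'I_Nc.+1 -> Omega -> M)                 (* Psi^{-1}(Y^N_{iT}) *)
  (Z : 'I_Nc.+1 -> 'I_p -> R)
  (beta : 'I_T0 -> R * R -> R) (eta : 'I_p -> R -> R)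
  (eps : 'I_Nc.+1 -> Omega -> R -> R) (sigma : R)
  (gamma : 'I_Nc -> R)
  (nuhat : Omega -> M) (delta : R) :
  std_space mu ->
  is_metric d ->
  (forall a, memL2 mu (Psi a)) ->
  (forall a b, d a b = normH mu (Psi a \- Psi b)) ->
  (* Y = Psi(M) is nonempty, convex and closed in H *)
  (exists a : M, True) ->
  (forall a b (l : R), 0 <= l <= 1 ->
     exists c, {ae mu, forall x, Psi c x = l * Psi a x + (1 - l) * Psi b x}) ->
  (forall (s : nat -> M) (f : R -> R), memL2 mu f ->
     (fun n => normH mu (Psi (s n) \- f)) @ \oo --> 0%R ->
     exists c, {ae mu, forall x, Psi c x = f x}) ->
  (0 < T0)%N ->
  (* pre-treatment outcomes lie in Y *)
  (forall i t, exists a, Ypre i t = Psi a) ->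
  (* coefficients *)
  (forall t, memL2ker mu (beta t)) ->
  (forall l, memL2 mu (eta l)) ->
  (* errors: independent, mean-zero, H-valued, a.s. bounded by sigma *)
  (forall i, H_random_element mu (eps i)) ->
  H_independent mu P eps ->
  (forall i, H_mean_zero mu P (eps i)) ->
  (forall i, {ae P, forall w, normH mu (eps i w) <= sigma}) ->
  (* autoregressive model with covariates, for every unit i *)
  (forall i w, {ae mu, forall x,
     Psi (nuN i w) x =
       \sum_(t < T0) kerop mu (beta t) (Ypre i t) x
       + \sum_(l < p) eta l x * Z i l + eps i w x}) ->
  (* weights *)
  \sum_(j < Nc) gamma j = 1 ->
  (* estimator: Psi (nuhat w) is the projection of
     hatY w = sum_j gamma_j Y_{jT} onto Y, i.e. nuhat = Psi^{-1}(tildeY) *)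
  (forall w a,
     normH mu (Psi (nuhat w) \- (fun x => \sum_(j < Nc) gamma j * Psi (nuN (lift ord0 j) w) x))
     <= normH mu (Psi a \- (fun x => \sum_(j < Nc) gamma j * Psi (nuN (lift ord0 j) w) x))) ->
  0 < delta ->
  exists A : set Omega, measurable A /\
    (A `<=` [set w | d (nuN ord0 w) (nuhat w) <=
        Num.sqrt (\sum_(t < T0) normker2 mu (beta t))
        * Num.sqrt (\sum_(t < T0)
             normH mu (fun x => Ypre ord0 t x
                          - \sum_(j < Nc) gamma j * Ypre (lift ord0 j) t x) ^+ 2)
        + Num.sqrt (\sum_(l < p) normH mu (eta l) ^+ 2)
          * euclid_norm (fun l => Z ord0 l - \sum_(j < Nc) gamma j * Z (lift ord0 j) l)
        + delta * sigma * (1 + euclid_norm gamma)]) /\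
    ((1 - 2 * expR (- (delta ^+ 2) / 2))%:E <= P A)%E.
Proof.
move=> std_mu _ L2Psi dE _ convex _ _ Ypsi L2beta L2eta rand indep mean bound model.
move=> _ proj d0.
have [m muE] := finite_sigma_finite (std_space_fin std_mu); subst mu.
have [K [h approx]] := std_space_orthonormal_approximation std_mu.
pose noise w := normH m (\sum_(i < Nc.+1) contrast_weight gamma i *: eps i w).
pose r := delta * euclid_norm (fun i => contrast_weight gamma i * sigma).
have measurable_tail : measurable [set w | r < noise w].
  by apply: measurable_gt; exact: (measurable_normH_weighted_sum _ rand approx).
exists (~` [set w | r < noise w]); split; first exact: measurableC.
split=> [w /negP|]; last first.
  rewrite probability_setC// EFinB leeB//.
  exact: (normH_weighted_sum_tail _ rand indep mean bound approx d0).
rewrite -leNgt => noise_le; rewrite /= dE.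
have L2hatY := memL2_lincomb gamma (fun j => L2Psi (nuN (lift ord0 j) w)).
apply: le_trans (nearest_in_convex_dist_le (nuN ord0 w) L2Psi L2hatY convex (proj w)) _.
have L2Y i t : memL2 m (Ypre i t) by have [a ->] := Ypsi i t.
apply: le_trans (normH_contrast_regression_le gamma L2beta L2eta L2Y
  (fun i => (rand i).1 w) (fun i => L2Psi (nuN i w)) (model ^~ w)) _.
rewrite lerD2l (le_trans noise_le)// /r -mulrA ler_pM2l//.
apply: euclid_norm_contrast_weightMr.
exact: ae_le_ge0 (fun w => normH_ge0 m _) (bound ord0).
Qed.
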